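(* Let $n\ge 1$ and let $V$ be any polynomial finite-dimensional irreducible representation of $\mathrm{GL}_n=\mathrm{GL}_n(\mathbb{C})$. Then the big algebra $\mathscr{B}(V)$ is commutative.
   Context: Let $\mathfrak{gl}_n$ be the Lie algebra of complex $n\times n$ matrices, with matrix units $E_{ij}$ and corresponding coordinate functions $y_{ij}$, so that $S(\mathfrak{gl}_n^* )=\mathbb{C}[\mathfrak{gl}_n]=\mathbb{C}[y_{ij}]$. For $0\le k\le n$ let $c_k\in S(\mathfrak{gl}_n^* )^{\mathfrak{gl}_n}$ be defined by $\det(Y-z\cdot\mathrm{Id}_n)=\sum_{k=0}^n(-1)^{n-k}c_k(Y)z^{n-k}$, i.e. $c_k(Y)$ is the sum of the principal $k\times k$ minors of $Y$. For a representation $V$ of $\mathrm{GL}_n$ with associated Lie algebra representation $\pi:\mathfrak{gl}_n\to\mathrm{End}\,V$, the Kirillov algebra is $\mathscr{C}(V)=(S(\mathfrak{gl}_n^* )\otimes\mathrm{End}\,V)^{\mathrm{GL}_n}$, i.e. the algebra (under pointwise multiplication) of $\mathrm{GL}_n$-equivariant polynomial maps $\mathfrak{gl}_n\to\mathrm{End}\,V$ (with $\mathrm{GL}_n$ acting by the adjoint action on $\mathfrak{gl}_n$ and by conjugation on $\mathrm{End}\,V$). An element $c\in S(\mathfrak{gl}_n^* )^{\mathfrak{gl}_n}$ is identified with the scalar element $Y\mapsto c(Y)\,\mathrm{Id}_V$. The Kirillov--Wei operator $\mathbf{D}:\mathscr{C}(V)\to\mathscr{C}(V)$ is $(\mathbf{D}F)(Y)=\sum_{i,j=1}^n\frac{\partial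 F}{\partial y_{ji}}(Y)\cdot\pi(E_{ij})$. The big algebra $\mathscr{B}(V)$ is the subalgebra of $\mathscr{C}(V)$ generated by the elements $M_{p,q}=\mathbf{D}^q(c_{p+q})$ for $p,q\ge 0$, $p+q\le n$. *)

(* Defs.v *)
From HB Require Import structures.
From mathcomp Require Import all_boot all_order all_algebra.
From mathcomp Require Import mpoly complex.
From mathcomp Require Import reals.

Set Implicit Arguments.
Unset Strict Implicit.
Unset Printing Implicit Defensive.

Import GRing.Theory.
Local Open Scope ring_scope.

Section PolynomialMaps.
Variables (K : fieldType) (n : nat).

(* The coordinate y_ij is the variable numbered [mxvec_index i j], so that
   evaluation at [Y] substitutes the entries of [mxvec Y].  An element of
   S(gl_n^* ) (x) End(K^m) is an m x m matrix over K[y_ij]. *)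
Definition evalmx m (F : 'M[{mpoly K[n * n]}]_m) (Y : 'M[K]_n) : 'M[K]_m :=
  map_mx (meval (fun k => mxvec Y 0 k)) F.

Definition dermx m (i j : 'I_n) (F : 'M[{mpoly K[n * n]}]_m) :=
  map_mx (mderiv (mxvec_index i j)) F.

Definition constmx m (A : 'M[K]_m) : 'M[{mpoly K[n * n]}]_m :=
  map_mx (@mpolyC (n * n) K) A.

Definition genericmx : 'M[{mpoly K[n * n]}]_n :=
  \matrix_(i, j) 'X_(mxvec_index i j).

(* det (Y - z) = \sum_(k <= n) (-1)^(n-k) c_k z^(n-k); meaningful for k <= n *)
Definition invc (k : nat) : {mpoly K[n * n]} :=
  (-1) ^+ (n - k) * (\det (map_mx polyC genericmx - 'X%:M))`_(n - k).

Definition is_subalg m (A : 'M[{mpoly K[n * n]}]_m -> Prop) : Prop :=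
  [/\ A 1%:M,
      forall F G, A F -> A G -> A (F + G),
      forall (a : K) F, A F -> A (a%:MP *: F)
    & forall F G, A F -> A G -> A (F *m G)].

Definition subalg_generated_in m (B gens : 'M[{mpoly K[n * n]}]_m -> Prop)
    (F : 'M[{mpoly K[n * n]}]_m) : Prop :=
  forall A : 'M[{mpoly K[n * n]}]_m -> Prop, is_subalg A ->
    (forall G, A G -> B G) -> (forall G, gens G -> A G) -> A F.

End PolynomialMaps.

(* A polynomial representation of GL_n(K) on the column space K^m, given by
   its matrix coefficients; only the values at invertible g are meant.  Over
   an infinite field these values determine [rep_coef]. *)
Record polyRep (K : fieldType) (n m : nat) := PolyRep {
  rep_coef : 'M[{mpoly K[n * n]}]_m;
  rep_one : evalmx rep_coef 1%:M = 1%:M;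
  rep_mul : forall g h : 'M[K]_n, g \in unitmx -> h \in unitmx ->
    evalmx rep_coef (g *m h) = evalmx rep_coef g *m evalmx rep_coef h }.

Section BigAlgebra.
Variables (K : fieldType) (n m : nat) (rho : polyRep K n m).

Definition rep (g : 'M[K]_n) : 'M[K]_m := evalmx (rep_coef rho) g.

Definition irreducible_rep : Prop :=
  (0 < m)%N /\
  forall U : {vspace 'cV[K]_m},
    (forall g : 'M[K]_n, g \in unitmx ->
       forall u : 'cV[K]_m, u \in U -> rep g *m u \in U) ->
    U = 0%VS \/ U = fullv.

(* the differential of [rep] at the identity, applied to X *)
Definition lie_rep (X : 'M[K]_n) : 'M[K]_m :=
  \sum_(i < n) \sum_(j < n) X i j *: evalmx (dermx i j (rep_coef rho)) 1%:M.

Definition kirillov_algebra (F : 'M[{mpoly K[n * n]}]_m) : Prop :=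
  forall g Y : 'M[K]_n, g \in unitmx ->
    evalmx F (g *m Y *m invmx g) = rep g *m evalmx F Y *m invmx (rep g).

Definition kirillov_wei (F : 'M[{mpoly K[n * n]}]_m) : 'M[{mpoly K[n * n]}]_m :=
  \sum_(i < n) \sum_(j < n)
    dermx j i F *m constmx n (lie_rep (delta_mx i j)).

Definition bigM (p q : nat) : 'M[{mpoly K[n * n]}]_m :=
  iter q kirillov_wei (invc K n (p + q))%:M.

Definition big_algebra : 'M[{mpoly K[n * n]}]_m -> Prop :=
  subalg_generated_in kirillov_algebra
    (fun F => exists p q : nat, (p + q <= n)%N /\ F = bigM p q).

End BigAlgebra.

(* Main.v *)
(* Write N(s,z) for rho(1 + s d/dY) det(z - Y), where the Taylor expansion of rho at
   the identity turns it into a constant coefficient differential operator in Y with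
   values in End V.  Second derivatives of det(z - Y) along [y_ij] and [y_kl] change
   sign when the column indices are exchanged, so the space spanned by the s- and
   z-coefficients of N(s,z) is stable under the Kirillov-Wei operator D.  It contains
   the c_k, hence all D^q(c_k), and it suffices that N(s,z) and N(t,w) commute for
   s != t.

   Multiplicativity of rho gives N(s,z) N(t,w) = rho((1 + s dA)(1 + t dB)) det A det B
   at A = z - Y, B = w - Y (up to signs and transposes).  The polynomial
     Phi(A,B,X) = sum_k k! [r^k] det((A + sX)(B + tX) + r s t X)
   satisfies dX Phi = (s dA + t dB + s t dA dB) Phi, a consequence of a Capelli-type
   identity for det(PQ + Z), and restricts to det A det B at X = 0.  So the product
   is rho(1 + dX) Phi at X = 0.  Finally, when A - B is scalar and s != t, the matrix
   s t X is a combination of P = A + sX, Q = B + tX and 1, so the determinant has the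
   form det((P - k)(Q + k) + c), which is unchanged when the two factors are
   exchanged. *)
Require Import Defs.
From HB Require Import structures.
From mathcomp Require Import all_boot all_order all_algebra.
From mathcomp Require Import mpoly complex.
From mathcomp Require Import reals.
From mathcomp Require Import all_fingroup ssrcomplements ring.

Set Implicit Arguments.
Unset Strict Implicit.
Unset Printing Implicit Defensive.

Import GRing.Theory Num.Theory.
Local Open Scope ring_scope.

(** * Constant coefficient differential operators and substitutions *)

Lemma mpoly_ind_XM (K : comNzRingType) n (P : {mpoly K[n]} -> Prop) :
  (forall c, P c%:MP) -> (forall p q, P p -> P q -> P (p + q)) ->
  (forall i p, P p -> P ('X_i * p)) -> forall p, P p.
Proof.
move=> PC PD PX; elim/mpolyind => [|c m p _ _ Pp]; first by rewrite -mpolyC0.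
apply: PD => //; rewrite mpolyXE_id -mul_mpolyC mulrC.
elim: (index_enum _) => [|i s IH]; first by rewrite big_nil mul1r.
rewrite big_cons -mulrA; elim: (m i) => [|k IHk]; first by rewrite mul1r.
by rewrite exprS -mulrA; apply: PX.
Qed.

(* p(d/dx) F, the polynomial p being the symbol of the operator *)
HB.lock Definition diffop (K : fieldType) N (p F : {mpoly K[N]}) : {mpoly K[N]} :=
  \sum_(m <- msupp p) p@_m *: F^`M[m].
Arguments diffop {K N}.

Section DiffOp.
Variables (K : fieldType) (N : nat).
Implicit Types p q F G : {mpoly K[N]}.


Lemma diffopE k p F : (msize p <= k)%N ->
  diffop p F = \sum_(m : 'X_{1..N < k}) p@_m *: F^`M[m].
Proof.
move=> le_pk; rewrite diffop.unlock (big_mksub 'X_{1..N < k}) ?msupp_uniq //=.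
  by rewrite big_rmcond //= => j /memN_msupp_eq0 ->; rewrite scale0r.
by move=> x /msize_mdeg_lt /leq_trans; apply.
Qed.

Lemma diffop_linearl F : linear (diffop^~ F).
Proof.
move=> c p q; pose k := maxn (msize (c *: p + q)) (maxn (msize p) (msize q)).
rewrite !(@diffopE k) /k ?leq_max ?leqnn ?orbT // scaler_sumr -big_split /=.
by apply: eq_bigr => m _; rewrite mcoeffD mcoeffZ scalerDl scalerA.
Qed.

Lemma diffop_linear p : linear (diffop p).
Proof.
move=> c F G; rewrite diffop.unlock scaler_sumr -big_split /=.
by apply: eq_bigr => m _; rewrite linearP scalerDr !scalerA mulrC.
Qed.

HB.instance Definition _ p :=
  GRing.isLinear.Build K {mpoly K[N]} {mpoly K[N]} _ (diffop p) (diffop_linear p).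

Lemma diffopDl p q F : diffop (p + q) F = diffop p F + diffop q F.
Proof. by have := diffop_linearl F 1 p q; rewrite !scale1r. Qed.

Lemma diffopZl c p F : diffop (c *: p) F = c *: diffop p F.
Proof.
have d0 : diffop 0 F = 0 by rewrite diffop.unlock msupp0 big_nil.
by have := diffop_linearl F c p 0; rewrite !addr0 d0 addr0.
Qed.

Lemma diffop_suml (I : Type) (r : seq I) (P : pred I) (f : I -> {mpoly K[N]}) F :
  diffop (\sum_(i <- r | P i) f i) F = \sum_(i <- r | P i) diffop (f i) F.
Proof.
apply: (big_morph (diffop^~ F)) => [p q|]; first exact: diffopDl.
by rewrite diffop.unlock msupp0 big_nil.
Qed.

Lemma diffopC c F : diffop c%:MP F = c *: F.
Proof.
have -> : c%:MP = c *: 1 :> {mpoly K[N]} by rewrite -mul_mpolyC mulr1.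
by rewrite diffopZl diffop.unlock msupp1 big_seq1 mcoeff1 eqxx scale1r mderivm0m.
Qed.

Lemma diffop1 F : diffop 1 F = F.
Proof. by rewrite -mpolyC1 diffopC scale1r. Qed.

Lemma diffopXm m F : diffop 'X_[m] F = F^`M[m].
Proof. by rewrite diffop.unlock msuppX big_seq1 mcoeffX eqxx scale1r. Qed.

Lemma diffopX i F : diffop 'X_i F = F^`M(i).
Proof. by rewrite diffopXm mderivmU1m. Qed.

Lemma mderiv_diffop i p F : (diffop p F)^`M(i) = diffop p (F^`M(i)).
Proof.
rewrite diffop.unlock linear_sum; apply: eq_bigr => m _ /=; rewrite mderivZ.
by rewrite -!mderivmU1m -!mderivmDm addmC.
Qed.

Lemma diffopXM i p F : diffop ('X_i * p) F = (diffop p F)^`M(i).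
Proof.
rewrite [in LHS](mpolyE p) mulr_sumr diffop_suml [in RHS]diffop.unlock linear_sum.
apply: eq_bigr => m _ /=.
by rewrite -scalerAr -mpolyXD diffopZl diffopXm addmC mderivmDm mderivmU1m mderivZ.
Qed.

Lemma diffopM p q F : diffop (p * q) F = diffop p (diffop q F).
Proof.
elim/mpoly_ind_XM: p => [c|p1 p2 IH1 IH2|i p IH].
- by rewrite mul_mpolyC diffopZl diffopC.
- by rewrite mulrDl !diffopDl IH1 IH2.
by rewrite -mulrA !diffopXM IH.
Qed.

End DiffOp.

HB.lock Definition msubst (K : fieldType) N M (g : 'I_N -> {mpoly K[M]}) (f : {mpoly K[N]}) :
  {mpoly K[M]} := mmap (@mpolyC M K) g f.
Arguments msubst {K N M}.

Section Subst.
Variables (K : fieldType).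

Section SubstMorphism.
Variables (N M : nat) (g : 'I_N -> {mpoly K[M]}).

Lemma msubst_is_linear : linear (msubst g).
Proof. move=> c p q; by rewrite msubst.unlock mmapD mmapZ mul_mpolyC. Qed.

Lemma msubst_is_monoid_morphism : monoid_morphism (msubst g).
Proof. by split=> [|p q]; rewrite msubst.unlock ?rmorph1 // rmorphM. Qed.

HB.instance Definition _ :=
  GRing.isLinear.Build K {mpoly K[N]} {mpoly K[M]} _ (msubst g) msubst_is_linear.
HB.instance Definition _ :=
  GRing.isMonoidMorphism.Build {mpoly K[N]} {mpoly K[M]} (msubst g)
    msubst_is_monoid_morphism.

Lemma msubstD : {morph msubst g : p q / p + q}. Proof. exact: raddfD. Qed.
Lemma msubstM : {morph msubst g : p q / p * q}. Proof. exact: rmorphM. Qed.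
Lemma msubstC c : msubst g c%:MP = c%:MP. Proof. by rewrite msubst.unlock; apply: mmapC. Qed.
Lemma msubstX i : msubst g 'X_i = g i. Proof. by rewrite msubst.unlock [LHS]mmapX mmap1U. Qed.

End SubstMorphism.

(* A linear map intertwining the operators g_i with the g'_i intertwines all
   polynomials in them. *)
Lemma diffop_intertwine N M M' (T : {linear {mpoly K[M]} -> {mpoly K[M']}})
    (g : 'I_N -> {mpoly K[M]}) (g' : 'I_N -> {mpoly K[M']}) :
  (forall i F, T (diffop (g i) F) = diffop (g' i) (T F)) ->
  forall f F, T (diffop (msubst g f) F) = diffop (msubst g' f) (T F).
Proof.
move=> Tg; elim/mpoly_ind_XM => [c|p q IHp IHq|i p IH] F.
- by rewrite !msubstC !diffopC linearZ.
- by rewrite !msubstD !diffopDl linearD IHp IHq.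
by rewrite !msubstM !msubstX !diffopM Tg IH.
Qed.

Lemma diffop_subst_eq N M (g g' : 'I_N -> {mpoly K[M]}) F :
  (forall i, diffop (g i) F = diffop (g' i) F) ->
  forall f, diffop (msubst g f) F = diffop (msubst g' f) F.
Proof.
move=> eq_g; elim/mpoly_ind_XM => [c|p q IHp IHq|i p IH].
- by rewrite !msubstC.
- by rewrite !msubstD !diffopDl IHp IHq.
rewrite !msubstM !msubstX [LHS]diffopM IH -[LHS]diffopM [g i * _]mulrC.
by rewrite [LHS]diffopM eq_g -[LHS]diffopM [_ * g' i]mulrC.
Qed.

Lemma mderivXU N i j : ('X_i : {mpoly K[N]})^`M(j) = (i == j)%:R.
Proof.
rewrite mderivX mnm1E; case: eqP => [->|_]; last by rewrite scale0r.
by rewrite -[X in (X - _)%MM]add0m addmK mpolyX0 scale1r.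
Qed.

Lemma mderiv_subst N M (g : 'I_N -> {mpoly K[M]}) k f :
  (msubst g f)^`M(k) = \sum_i msubst g f^`M(i) * (g i)^`M(k).
Proof.
elim/mpoly_ind_XM: f => [c|p q IHp IHq|i p IH].
- by rewrite msubstC mderivC big1 // => i _; rewrite mderivC linear0 mul0r.
- rewrite msubstD mderivD IHp IHq -big_split; apply: eq_bigr => i _ /=.
  by rewrite mderivD msubstD mulrDl.
rewrite msubstM msubstX mderivM IH mulr_sumr.
transitivity (\sum_j ((i == j)%:R * (msubst g p * (g j)^`M(k))) +
   \sum_j g i * (msubst g p^`M(j) * (g j)^`M(k))); last first.
  rewrite -big_split; apply: eq_bigr => j _ /=.
  rewrite mderivM msubstD !msubstM msubstX mderivXU mulrDl !mulrA.
  by rewrite (rmorph_nat (msubst g)).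
congr (_ + _); rewrite (bigD1 i) //= eqxx mul1r big1 ?addr0 => [|j].
  by rewrite mulrC.
by rewrite eq_sym => /negPf->; rewrite mul0r.
Qed.

Lemma msubst_comp N M M' (g : 'I_N -> {mpoly K[M]}) (h : 'I_M -> {mpoly K[M']}) f :
  msubst h (msubst g f) = msubst (fun i => msubst h (g i)) f.
Proof.
elim/mpoly_ind_XM: f => [c|p q IHp IHq|i p IH]; first by rewrite !msubstC.
  by rewrite !msubstD IHp IHq.
by rewrite !msubstM IH !msubstX.
Qed.

Lemma meval_msubst N M (g : 'I_N -> {mpoly K[M]}) v f :
  (msubst g f).@[v] = f.@[fun i => (g i).@[v]].
Proof.
elim/mpoly_ind_XM: f => [c|p q IHp IHq|i p IH]; first by rewrite msubstC !mevalC.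
  by rewrite msubstD !mevalD IHp IHq.
by rewrite msubstM !mevalM IH msubstX mevalXU.
Qed.

Lemma msubst_id N (f : {mpoly K[N]}) : msubst (fun i => 'X_i) f = f.
Proof.
elim/mpoly_ind_XM: f => [c|p q IHp IHq|i p IH]; first by rewrite msubstC.
  by rewrite msubstD IHp IHq.
by rewrite msubstM IH msubstX.
Qed.

Lemma eq_msubst N M (g h : 'I_N -> {mpoly K[M]}) : g =1 h -> msubst g =1 msubst h.
Proof.
move=> eq_gh f; rewrite msubst.unlock /mmap; apply: eq_bigr => m _.
by rewrite (mmap1_eq _ eq_gh).
Qed.

End Subst.

(** * Polynomials vanishing at every point *)

Lemma mcoeff0_meval (K : fieldType) N (q : {mpoly K[N]}) : q@_0 = q.@[fun=> 0].
Proof.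
elim/mpoly_ind_XM: q => [c|p1 p2 IH1 IH2|i q _]; first by rewrite mevalC mpolyCK.
  by rewrite mevalD mcoeffD IH1 IH2.
by rewrite mevalM mevalXU mul0r rmorphM /= mcoeffX mnm1_eq0 mul0r.
Qed.

Section Evaluation.
Variable K : numFieldType.

Lemma poly_nat_roots_eq0 (q : {poly K}) : (forall k : nat, q.[k%:R] = 0) -> q = 0.
Proof.
move=> q0; apply/eqP; case: (eqVneq q 0) => // qn0.
have := @max_poly_roots _ q [seq k%:R | k <- iota 0 (size q)] qn0.
rewrite size_map size_iota ltnn => /(_ _ _)/negP; case=> //.
  by apply/allP => _ /mapP[k _ ->]; rewrite rootE q0.
by rewrite map_inj_uniq ?iota_uniq // => a b /eqP; rewrite eqr_nat => /eqP.
Qed.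

Section Line.
Variables (N : nat) (v : 'I_N -> K) (i : 'I_N).
Let line (p : {mpoly K[N]}) : {poly K} :=
  mmap polyC (fun j => (v j)%:P + (i == j)%:R *: 'X) p.

Let lineX j p : line ('X_j * p) = ((v j)%:P + (i == j)%:R *: 'X) * line p.
Proof. by rewrite /line rmorphM /= mmapX mmap1U. Qed.

Let line_horner p t : (line p).[t] = p.@[fun j => v j + (i == j)%:R * t].
Proof.
elim/mpoly_ind_XM: p => [c|p q IHp IHq|j p IH].
- by rewrite /line mmapC hornerC mevalC.
- by rewrite /line mmapD hornerD -/(line p) -/(line q) IHp IHq mevalD.
by rewrite lineX mevalM mevalXU hornerM IH !hornerE.
Qed.

Let line_deriv p : ((line p)^`()).[0] = p^`M(i).@[v].
Proof.
have line0 q : (line q).[0] = q.@[v].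
  by rewrite line_horner; apply: meval_eq => j; rewrite mulr0 addr0.
elim/mpoly_ind_XM: p => [c|p q IHp IHq|j p IH].
- by rewrite /line mmapC derivC hornerC mderivC meval0.
- by rewrite /line mmapD derivD hornerD -/(line p) -/(line q) IHp IHq mderivD mevalD.
rewrite lineX mderivM mevalD !mevalM mevalXU derivM derivD derivC derivZ derivX.
rewrite !hornerE IH line0 mderivXU eq_sym.
by rewrite (rmorph_nat (meval v)).
Qed.

Lemma mderiv_vanish (p : {mpoly K[N]}) :
  (forall w, p.@[w] = 0) -> p^`M(i).@[v] = 0.
Proof.
move=> p0; rewrite -line_deriv (@poly_nat_roots_eq0 (line p)) ?deriv0 ?horner0 //.
by move=> k; rewrite line_horner p0.
Qed.

End Line.

Lemma meval_eq0P N (p : {mpoly K[N]}) : (forall v, p.@[v] = 0) -> p = 0.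
Proof.
move=> p0; apply/mpolyP => m; rewrite mcoeff0.
have: p^`M[m].@[fun=> 0] = 0.
  rewrite mderivm_foldr.
  suff: forall v, (foldr (@mderiv N K) p (flatten [seq nseq (m i) i | i <- enum 'I_N])).@[v] = 0
    by apply.
  elim: (flatten _) => //= i s IH v; exact: mderiv_vanish.
rewrite -mcoeff0_meval mcoeff_mderivm addm0 => /eqP; rewrite mulrn_eq0 => /orP[|/eqP//].
rewrite eqn0Ngt prodn_gt0 // => i; by rewrite ffactnn fact_gt0.
Qed.

Lemma eq_meval N (p q : {mpoly K[N]}) : (forall v, p.@[v] = q.@[v]) -> p = q.
Proof.
by move=> eq_pq; apply/eqP; rewrite -subr_eq0; apply/eqP/meval_eq0P => v;
  rewrite mevalB eq_pq subrr.
Qed.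

End Evaluation.

(** * A Capelli-type identity for determinants *)

Section RowReplace.
Variables (A : comNzRingType) (n : nat).
Implicit Types (C : 'M[A]_n) (u v : 'I_n -> A).

Definition rowrep (i : 'I_n) u C : 'M[A]_n :=
  \matrix_(a, b) if a == i then u b else C a b.

Definition ebase (j b : 'I_n) : A := (b == j)%:R.

Lemma det_rowrep i u C : \det (rowrep i u C) = \sum_j u j * cofactor C i j.
Proof.
rewrite (expand_det_row _ i); apply: eq_bigr => j _; rewrite mxE eqxx.
congr (_ * (_ * \det _)); apply/matrixP => a b; rewrite !mxE.
by rewrite eq_sym (negPf (neq_lift _ _)).
Qed.

Lemma det_rowrep_ebase i j C : \det (rowrep i (ebase j) C) = cofactor C i j.
Proof.
rewrite det_rowrep (bigD1 j) //= /ebase eqxx mul1r big1 ?addr0 // => k /negPf->.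
by rewrite mul0r.
Qed.

Lemma eq_rowrep i u v C : u =1 v -> rowrep i u C = rowrep i v C.
Proof. by move=> eq_uv; apply/matrixP => a b; rewrite !mxE eq_uv. Qed.

Lemma rowrep_self i C : rowrep i (C i) C = C.
Proof. by apply/matrixP => a b; rewrite mxE; case: eqP => [->|]. Qed.

Lemma det_rowrep_swap i p u v C : i != p ->
  \det (rowrep i u (rowrep p v C)) = - \det (rowrep i v (rowrep p u C)).
Proof.
move=> ne_ip; rewrite -mulN1r.
have -> : rowrep i u (rowrep p v C) = xrow i p (rowrep i v (rowrep p u C)).
  apply/matrixP => a b; rewrite !mxE.
  case: tpermP => [->|->|/eqP/negPf-> /eqP/negPf->] //; rewrite ?eqxx //.
    by rewrite eq_sym (negPf ne_ip).
  by rewrite eq_sym (negPf ne_ip).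
by rewrite xrowE det_mulmx det_perm odd_tperm ne_ip expr1.
Qed.

End RowReplace.

Definition derivation (A : nzRingType) (d : A -> A) :=
  (forall x y, d (x + y) = d x + d y) /\ (forall x y, d (x * y) = d x * y + x * d y).

Section Derivation.
Variables (A : comNzRingType) (d : A -> A).
Hypothesis der_d : derivation d.

Lemma derivationD x y : d (x + y) = d x + d y. Proof. by case: der_d. Qed.
Lemma derivationM x y : d (x * y) = d x * y + x * d y. Proof. by case: der_d. Qed.
Lemma derivation0 : d 0 = 0.
Proof. by apply: (addrI (d 0)); rewrite -derivationD !addr0. Qed.
Lemma derivation1 : d 1 = 0.
Proof. by apply: (addrI (d 1)); rewrite -{3}(mulr1 1) derivationM mulr1 mul1r addr0. Qed.
Lemma derivationN x : d (- x) = - d x.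
Proof. by apply: (addrI (d x)); rewrite -derivationD !subrr derivation0. Qed.
Lemma derivation_nat k : d k%:R = 0.
Proof.
elim: k => [|k IH]; first exact: derivation0.
by rewrite -addn1 natrD derivationD IH derivation1 addr0.
Qed.
Lemma derivation_sum (I : Type) (r : seq I) (P : pred I) (F : I -> A) :
  d (\sum_(i <- r | P i) F i) = \sum_(i <- r | P i) d (F i).
Proof. by apply: (big_morph d); [exact: derivationD | exact: derivation0]. Qed.

Lemma derivation_det n (C : 'M[A]_n) :
  d (\det C) = \sum_p \det (rowrep p (fun b => d (C p b)) C).
Proof.
rewrite /determinant derivation_sum exchange_big /=; apply: eq_bigr => s _.
have dprod (r : seq 'I_n) : uniq r -> d (\prod_(i <- r) C i (s i)) =
    \sum_(p <- r) d (C p (s p)) * \prod_(i <- r | i != p) C i (s i).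
  elim: r => [|i r IH] /=; first by rewrite !big_nil derivation1.
  case/andP=> ir ur; rewrite !big_cons derivationM IH // eqxx /=; congr (_ * _ + _).
    by rewrite big_seq_cond [RHS]big_seq_cond; apply: eq_bigl => k;
      rewrite andbT; case: (boolP (k \in r)) => //= kr; apply/esym;
      apply: contraNneq ir => <-.
  rewrite mulr_sumr big_seq [RHS]big_seq; apply: eq_bigr => p pr.
  rewrite big_cons ifT; first by rewrite mulrCA.
  by apply: contraNneq ir => ->.
rewrite derivationM dprod ?index_enum_uniq //.
have -> : d ((-1) ^+ s) = 0.
  by case: (odd_perm s); rewrite ?expr1 ?derivationN derivation1 ?oppr0.
rewrite mul0r add0r mulr_sumr; apply: eq_bigr => p _; congr (_ * _).
rewrite [RHS](bigD1 p) //= mxE eqxx; congr (_ * _); apply: eq_bigr => i /negPf ip.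
by rewrite mxE ip.
Qed.

Lemma derivation_cofactor n (C : 'M[A]_n) i j :
  d (cofactor C i j) = \sum_(p | p != i)
    \det (rowrep p (fun b => d (C p b)) (rowrep i (ebase A j) C)).
Proof.
rewrite -det_rowrep_ebase derivation_det (bigD1 i) //= [X in X + _](_ : _ = 0).
  rewrite add0r; apply: eq_bigr => p /negPf pi; congr (\det _).
  by apply: eq_rowrep => b; rewrite mxE pi.
rewrite det_rowrep big1 // => b _; rewrite mxE eqxx derivation_nat mul0r //.
Qed.

End Derivation.

Section CapelliIdentity.
Variables (A : comNzRingType) (n : nat).
Variables (alpha beta : 'I_n -> 'I_n -> A -> A) (euler : A -> A).
Variables (P Q Z : 'M[A]_n).
Hypothesis der_alpha : forall i k, derivation (alpha i k).
Hypothesis der_beta : forall k j, derivation (beta k j).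
Hypothesis der_euler : derivation euler.
Hypothesis alphaP : forall i k a b, alpha i k (P a b) = ((a == i) && (b == k))%:R.
Hypothesis alphaQ : forall i k a b, alpha i k (Q a b) = 0.
Hypothesis alphaZ : forall i k a b, alpha i k (Z a b) = 0.
Hypothesis betaP : forall k j a b, beta k j (P a b) = 0.
Hypothesis betaQ : forall k j a b, beta k j (Q a b) = ((a == k) && (b == j))%:R.
Hypothesis betaZ : forall k j a b, beta k j (Z a b) = 0.
Hypothesis eulerP : forall a b, euler (P a b) = 0.
Hypothesis eulerQ : forall a b, euler (Q a b) = 0.
Hypothesis eulerZ : forall a b, euler (Z a b) = Z a b.

Let C := P *m Q + Z.

Let alphaC i k a b : alpha i k (C a b) = (a == i)%:R * Q k b.
Proof.
rewrite !mxE derivationD // alphaZ addr0 derivation_sum // (bigD1 k) //=.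
rewrite derivationM // alphaP alphaQ mulr0 addr0 eqxx andbT big1 ?addr0 // => c /negPf ck.
by rewrite derivationM // alphaP alphaQ ck andbF mul0r mulr0 addr0.
Qed.

Let betaC k j a b : beta k j (C a b) = P a k * ebase A j b.
Proof.
rewrite !mxE derivationD // betaZ addr0 derivation_sum // (bigD1 k) //=.
rewrite derivationM // betaP betaQ mul0r add0r eqxx big1 ?addr0 // => c /negPf ck.
by rewrite derivationM // betaP betaQ ck mul0r mulr0 addr0.
Qed.

Let eulerC a b : euler (C a b) = Z a b.
Proof.
rewrite !mxE derivationD // eulerZ derivation_sum // big1 ?add0r // => c _.
by rewrite derivationM // eulerP eulerQ mul0r mulr0 addr0.
Qed.

Lemma det_beta k j : beta k j (\det C) = \sum_p P p k * cofactor C p j.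
Proof.
rewrite derivation_det //; apply: eq_bigr => p _; rewrite det_rowrep.
rewrite (bigD1 j) //= betaC /ebase eqxx mulr1 big1 ?addr0 // => b /negPf bj.
by rewrite betaC /ebase bj mulr0 mul0r.
Qed.

Let alpha_cofactor i k p j : p != i ->
  alpha i k (cofactor C p j) = \det (rowrep i (Q k) (rowrep p (ebase A j) C)).
Proof.
move=> pi; rewrite derivation_cofactor // (bigD1 i) ?(eq_sym i) //=.
rewrite [X in _ + X]big1 ?addr0 => [|a /andP[ap /negPf ai]].
  by congr (\det _); apply: eq_rowrep => b; rewrite alphaC eqxx mul1r.
by rewrite det_rowrep big1 // => b _; rewrite alphaC ai !mul0r.
Qed.

Let alpha_cofactor_self i k j : alpha i k (cofactor C i j) = 0.
Proof.
rewrite derivation_cofactor // big1 // => p /negPf pi.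
by rewrite det_rowrep big1 // => b _; rewrite alphaC pi !mul0r.
Qed.

Lemma capelli_det i j :
  \sum_k alpha i k (beta k j (\det C)) = cofactor C i j + euler (cofactor C i j).
Proof.
transitivity (\sum_k (cofactor C i j + \sum_(p | p != i)
    P p k * \det (rowrep i (Q k) (rowrep p (ebase A j) C)))).
  apply: eq_bigr => k _; rewrite det_beta derivation_sum //.
  rewrite (eq_bigr (fun p => (p == i)%:R * cofactor C p j +
      P p k * alpha i k (cofactor C p j))); last first.
    by move=> p _; rewrite derivationM // alphaP eqxx andbT.
  rewrite big_split /=; congr (_ + _).
    by rewrite (bigD1 i) //= eqxx mul1r big1 ?addr0 // => p /negPf->; rewrite mul0r.
  rewrite (bigD1 i) //= alpha_cofactor_self mulr0 add0r.
  by apply: eq_bigr => p pi; rewrite alpha_cofactor.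
rewrite big_split /= sumr_const card_ord exchange_big /=.
transitivity (cofactor C i j *+ n + \sum_(p | p != i) (- cofactor C i j +
    \det (rowrep p (Z p) (rowrep i (ebase A j) C)))).
  congr (_ + _); apply: eq_bigr => p pi.
  transitivity (\det (rowrep i (fun b => C p b - Z p b) (rowrep p (ebase A j) C))).
    under eq_bigr do rewrite det_rowrep mulr_sumr.
    rewrite exchange_big det_rowrep; apply: eq_bigr => b _ /=.
    rewrite !mxE addrK mulr_suml; apply: eq_bigr => k _; by rewrite mulrA.
  have ip : i != p by rewrite eq_sym.
  rewrite det_rowrep; under eq_bigr do rewrite mulrBl.
  rewrite sumrB -!det_rowrep [X in X - _]det_rowrep_swap // rowrep_self det_rowrep_ebase.
  rewrite [X in _ - X]det_rowrep_swap // opprK; congr (_ + \det _).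
  apply/matrixP => a b; rewrite !mxE.
  by case: eqP => [->|//]; rewrite (negPf ip).
rewrite big_split /= addrA (derivation_cofactor der_euler); congr (_ + _); last first.
  by apply: eq_bigr => p _; congr (\det _); apply: eq_rowrep => b; rewrite eulerC.
have -> : cofactor C i j *+ n = \sum_(p < n) cofactor C i j.
  by rewrite sumr_const card_ord.
by rewrite sumrN (bigD1 i) //= addrK.
Qed.

End CapelliIdentity.

Lemma mxvec_index_eq m n (i i' : 'I_m) (j j' : 'I_n) :
  (mxvec_index i j == mxvec_index i' j') = (i == i') && (j == j').
Proof. by rewrite (inj_eq (@cast_ord_inj _ _ _)) (inj_eq enum_rank_inj) xpair_eqE. Qed.

Lemma char_poly_mulmxC (R : comNzRingType) n (M N : 'M[R]_n) :
  char_poly (M *m N) = char_poly (N *m M).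
Proof.
pose pM := map_mx polyC M; pose pN := map_mx polyC N.
pose B := block_mx ('X%:M : 'M_n) pM pN 1%:M.
have detB1 : \det B = char_poly (M *m N).
  pose E := block_mx (1%:M : 'M[{poly R}]_n) (- pM) 0 1%:M.
  have : \det (E *m B) = \det B by rewrite det_mulmx det_ublock !det1 !mul1r.
  rewrite mulmx_block !mul1mx !mul0mx !mulmx1 !add0r addrN det_lblock det1 mulr1.
  move <-; rewrite /char_poly /char_poly_mx map_mxM.
  by congr (\det _); rewrite mulNmx.
have detB2 : 'X^n * \det B = 'X^n * char_poly (N *m M).
  pose E := block_mx (1%:M : 'M[{poly R}]_n) 0 (- pN) 'X%:M.
  have : \det (E *m B) = 'X^n * \det B.
    by rewrite det_mulmx det_lblock det1 mul1r det_scalar.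
  rewrite mulmx_block !mul1mx !mul0mx !mulmx1 !addr0 !mulNmx scalar_mxC addNr.
  rewrite det_ublock det_scalar => <-.
  rewrite /char_poly /char_poly_mx map_mxM; congr (_ * \det _).
  by rewrite addrC.
rewrite -detB1; apply: lreg_lead detB2.
by rewrite lead_coefXn; apply: lreg1.
Qed.

Lemma det_mulmxC_add (R : comNzRingType) n (M N : 'M[R]_n) c :
  \det (M *m N + c%:M) = \det (N *m M + c%:M).
Proof.
have evalE (L : 'M[R]_n) : \det (L + c%:M) = (-1) ^+ n * (char_poly L).[- c].
  rewrite -[_.[_]]/(horner_eval _ _) /char_poly -det_map_mx -detZ; congr (\det _).
  apply/matrixP => i j; rewrite !mxE rmorphB rmorphMn /= /horner_eval hornerX hornerC.
  by rewrite mulNrn mulN1r opprD !opprK addrC.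
by rewrite !evalE char_poly_mulmxC.
Qed.

Section PolyDerivation.
Variable R : comNzRingType.

Lemma derivation_map_poly (d : R -> R) : derivation d -> derivation (map_poly d).
Proof.
move=> der_d; have d0 := derivation0 der_d; split=> p q; apply/polyP => i.
  by rewrite coefD !coef_map_id0 // coefD (derivationD der_d).
rewrite coefD coef_map_id0 // !coefM (derivation_sum der_d) -big_split.
apply: eq_bigr => j _ /=.
by rewrite !coef_map_id0 // (derivationM der_d).
Qed.

Lemma derivation_euler : derivation (fun p : {poly R} => 'X * p^`()).
Proof.
split=> p q; first by rewrite derivD mulrDr.
by rewrite derivM mulrDr mulrA mulrCA.
Qed.

(* The linear functional with moments r^m |-> m! (formally, the integral against
   exp(-r) over the half-line). *)
Definition laplace (p : {poly R}) : R := \sum_(i < size p) p`_i *+ i`!.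

Lemma laplaceE k (p : {poly R}) : (size p <= k)%N ->
  laplace p = \sum_(i < k) p`_i *+ i`!.
Proof.
move=> le_pk; rewrite /laplace (big_ord_widen k (fun i => p`_i *+ i`!)) //.
rewrite big_mkcond; apply: eq_bigr => i _; case: ltnP => // le_pi.
by rewrite nth_default ?mul0rn.
Qed.

Lemma laplaceD p q : laplace (p + q) = laplace p + laplace q.
Proof.
pose k := maxn (size (p + q)) (maxn (size p) (size q)).
rewrite !(@laplaceE k) /k ?leq_max ?leqnn ?orbT // -big_split /=.
by apply: eq_bigr => i _; rewrite coefD mulrnDl.
Qed.

Lemma laplaceC c : laplace c%:P = c.
Proof. by rewrite (@laplaceE 1) ?size_polyC_leq1 // big_ord1 coefC mulr1n. Qed.

Lemma laplaceCM c p : laplace (c%:P * p) = c * laplace p.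
Proof.
pose k := maxn (size (c%:P * p)) (size p).
rewrite !(@laplaceE k) /k ?leq_max ?leqnn ?orbT // mulr_sumr.
by apply: eq_bigr => i _; rewrite coefCM mulrnAr.
Qed.

Lemma laplace_sum (I : Type) (r : seq I) (P : pred I) (F : I -> {poly R}) :
  laplace (\sum_(i <- r | P i) F i) = \sum_(i <- r | P i) laplace (F i).
Proof.
apply: (big_morph laplace); first exact: laplaceD.
by rewrite -polyC0 laplaceC.
Qed.

Lemma laplaceXM p : laplace ('X * p) = laplace (p + 'X * p^`()).
Proof.
pose k := maxn (size ('X * p)) (maxn (size (p + 'X * p^`())) (size p)).
rewrite !(@laplaceE k.+1) /k; try by rewrite leqW // !leq_max leqnn ?orbT.
rewrite big_ord_recl coefXM mul0rn add0r.
rewrite [RHS]big_ord_recr /= [in X in _ = _ + X]nth_default ?mul0rn ?addr0; last first.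
  by rewrite !leq_max leqnn ?orbT.
apply: eq_bigr => i _; rewrite /bump leq0n add1n coefXM coefD coefXM coef_deriv.
by case: (i : nat) => [|j] /=; rewrite ?addr0 // -mulrS factS mulrnA.
Qed.

End PolyDerivation.

Lemma laplace_map (R S : comNzRingType) (f : {additive R -> S}) p :
  laplace (map_poly f p) = f (laplace p).
Proof.
rewrite (@laplaceE _ (size p)) ?size_poly // raddf_sum.
by apply: eq_bigr => i _; rewrite coef_map raddfMn.
Qed.

Lemma laplace_derivation (R : comNzRingType) (d : R -> R) p : derivation d ->
  laplace (map_poly d p) = d (laplace p).
Proof.
move=> der_d; rewrite (@laplaceE _ (size p)) ?size_poly // (derivation_sum der_d).
apply: eq_bigr => i _; rewrite coef_map_id0 ?derivation0 //.
by elim: i`! => [|k IH]; rewrite ?mulr0n ?derivation0 // !mulrSr (derivationD der_d) IH.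
Qed.

(** * The polynomial Phi *)

Lemma derivation_mderiv (K : fieldType) N i : derivation (@mderiv N K i).
Proof. by split=> p q; [exact: mderivD | exact: mderivM]. Qed.

Lemma map_poly_derivC (R : comNzRingType) (d : R -> R) c : derivation d ->
  map_poly d c%:P = (d c)%:P.
Proof.
move=> der_d; apply/polyP => i; rewrite coef_map_id0 ?derivation0 // !coefC.
by case: eqP; rewrite // derivation0.
Qed.

Lemma map_poly_derivXC (R : comNzRingType) (d : R -> R) c : derivation d ->
  map_poly d ('X * c%:P) = 'X * (d c)%:P.
Proof.
move=> der_d; apply/polyP => i; rewrite coef_map_id0 ?derivation0 // !coefXM !coefC.
by case: ifP => _; [|case: ifP => _]; rewrite // derivation0.
Qed.

Lemma derivation_sub (R : comNzRingType) (d d' : R -> R) a :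
  derivation d -> derivation d' -> derivation (fun x => d x - a * d' x).
Proof.
move=> der_d der_d'; split=> x y; rewrite (derivationD der_d) (derivationD der_d')
  || rewrite (derivationM der_d) (derivationM der_d'); ring.
Qed.

(* Phi(a, b, x) *)
Definition fused (S : comNzRingType) n (a b x : 'M[S]_n) (s t : S) : S :=
  laplace (\det (map_mx polyC (a + s *: x) *m map_mx polyC (b + t *: x) +
                 'X *: map_mx polyC ((s * t) *: x))).

Lemma rmorph_fused (S S' : comNzRingType) (f : {rmorphism S -> S'}) n (a b x : 'M[S]_n) s t :
  f (fused a b x s t) = fused (map_mx f a) (map_mx f b) (map_mx f x) (f s) (f t).
Proof.
have [mf mfE] : exists mf : {rmorphism {poly S} -> {poly S'}}, map_poly f =1 mf.
  by exists (map_poly f).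
have mapC (M : 'M[S]_n) : map_mx mf (map_mx polyC M) = map_mx polyC (map_mx f M).
  by apply/matrixP => i j; rewrite !mxE -mfE map_polyC.
rewrite /fused -laplace_map mfE -det_map_mx map_mxD map_mxM map_mxZ 3!mapC -mfE map_polyX.
by rewrite !map_mxD !map_mxZ rmorphM.
Qed.

Lemma det_mulmx_sym (S : comNzRingType) n (P R : 'M[S]_n) k c :
  \det (P *m R + (k *: (P - R) - c%:M)) = \det (R *m P + (k *: (P - R) - c%:M)).
Proof.
have -> : P *m R + (k *: (P - R) - c%:M) = (P - k%:M) *m (R + k%:M) + (k * k - c)%:M.
  rewrite mulmxBl !mulmxDr mul_mx_scalar mul_scalar_mx -scalar_mxM scalerBr raddfB /=.
  move: (P *m R) (k *: P) (k *: R) (_%:M) (_%:M) => a b d e f.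
  by rewrite opprD !addrA addrNK addrAC.
rewrite det_mulmxC_add; congr (\det _).
rewrite mulmxDl !mulmxBr mul_mx_scalar mul_scalar_mx -scalar_mxM scalerBr raddfB /=.
move: (R *m P) (k *: P) (k *: R) (_%:M) (_%:M) => a b d e f.
by rewrite !addrA addrNK [a - d + b]addrAC.
Qed.

Lemma fused_sym (S : comNzRingType) n (a b x : 'M[S]_n) (s t c u : S) :
  (s - t) * u = 1 -> a - b = c%:M -> fused a b x s t = fused b a x t s.
Proof.
move=> su1 ab_c; rewrite /fused (mulrC t s); congr (laplace _).
set P := map_mx polyC (a + _); set R := map_mx polyC (b + _).
pose k := 'X * (s * t * u)%:P.
have -> : 'X *: map_mx polyC ((s * t) *: x) = k *: (P - R) - (k * c%:P)%:M.
  apply/matrixP => i j; have := congr1 (fun M : 'M_n => M i j) ab_c.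
  rewrite !mxE -polyCB => abE.
  have -> : a i j + s * x i j - (b i j + t * x i j) = c *+ (i == j) + (s - t) * x i j.
    by rewrite -abE; ring.
  rewrite polyCD mulrDr polyCMn mulrnAr addrAC subrr add0r /k -['X * _ * _]mulrA -polyCM.
  by congr (_ * _%:P); rewrite mulrA -[s * t * u * _]mulrA [u * _]mulrC su1 mulr1.
exact: det_mulmx_sym.
Qed.

Lemma fused0 (S : comNzRingType) n (a b : 'M[S]_n) s t :
  fused a b 0 s t = \det a * \det b.
Proof.
rewrite /fused !scaler0 map_mx0 scaler0 !addr0 det_mulmx !det_map_mx /=.
by rewrite -polyCM laplaceC.
Qed.

Section FusedDeterminant.
Variables (K : numFieldType) (n : nat).
Local Notation N := (n * n)%N.
Local Notation Q := {mpoly K[N + N + N]}.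

Definition ixA (i j : 'I_n) : 'I_(N + N + N) := lshift N (lshift N (mxvec_index i j)).
Definition ixB (i j : 'I_n) : 'I_(N + N + N) := lshift N (rshift N (mxvec_index i j)).
Definition ixX (i j : 'I_n) : 'I_(N + N + N) := rshift (N + N) (mxvec_index i j).
Definition varA : 'M[Q]_n := \matrix_(i, j) 'X_(ixA i j).
Definition varB : 'M[Q]_n := \matrix_(i, j) 'X_(ixB i j).
Definition varX : 'M[Q]_n := \matrix_(i, j) 'X_(ixX i j).

Let varE := (mxE, mderivXU, eq_lshift, eq_rshift, eq_lrshift, eq_rlshift, mxvec_index_eq).

Variables s t : K.

Let P := map_mx polyC (varA + s%:MP *: varX).
Let R := map_mx polyC (varB + t%:MP *: varX).
Let Z := 'X *: map_mx polyC ((s%:MP * t%:MP) *: varX).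

Let PE i j : P i j = (varA i j + s%:MP * varX i j)%:P.
Proof. by rewrite !mxE. Qed.
Let RE i j : R i j = (varB i j + t%:MP * varX i j)%:P.
Proof. by rewrite !mxE. Qed.
Let ZE i j : Z i j = 'X * ((s%:MP * t%:MP) * varX i j)%:P.
Proof. by rewrite !mxE. Qed.

Definition fused_det : Q := fused varA varB varX s%:MP t%:MP.

Let dd c : {poly Q} -> {poly Q} := map_poly (mderiv c).
Let der_dd c : derivation (dd c).
Proof. exact/derivation_map_poly/derivation_mderiv. Qed.

Let dd_entry c (u : K) (a b : Q) :
  dd c (a + u%:MP * b)%:P = (a^`M(c) + u%:MP * b^`M(c))%:P.
Proof.
by rewrite /dd map_poly_derivC; [rewrite mderivD mderiv_mulC | exact: derivation_mderiv].
Qed.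

Let dd_Z c a b : dd c (Z a b) = 'X * ((s%:MP * t%:MP) * (varX a b)^`M(c))%:P.
Proof.
by rewrite ZE -mpolyCM /dd map_poly_derivXC; [rewrite mderiv_mulC | exact: derivation_mderiv].
Qed.

(* dX - s dA - t dB kills both factors of C, leaving only the rank-one term. *)
Let twisted i j (p : {poly Q}) :=
  dd (ixX i j) p - (s%:MP)%:P * dd (ixA i j) p - (t%:MP)%:P * dd (ixB i j) p.

Let der_twisted i j : derivation (twisted i j).
Proof. by apply: derivation_sub => //; apply: derivation_sub. Qed.

Let twisted_entry i j a b :
  twisted i j ((P *m R + Z) a b) = ((s%:MP * t%:MP))%:P * 'X * ((a == i) && (b == j))%:R.
Proof.
have twP c d : twisted i j (P c d) = 0.
  rewrite /twisted PE !dd_entry !varE /=.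
  by rewrite -!polyCM -!polyCB; congr (_%:P); ring.
have twR c d : twisted i j (R c d) = 0.
  rewrite /twisted RE !dd_entry !varE /=.
  by rewrite -!polyCM -!polyCB; congr (_%:P); ring.
have -> : (P *m R + Z) a b = \sum_c P a c * R c b + Z a b.
  by rewrite [LHS]mxE [X in X + _ = _]mxE.
rewrite (derivationD (der_twisted _ _)).
rewrite (derivation_sum (der_twisted _ _)) big1 ?add0r => [|c _]; last first.
  by rewrite (derivationM (der_twisted _ _)) twP twR mul0r mulr0 addr0.
rewrite /twisted !dd_Z !varE /= !mulr0 !subr0 polyCM mulrA (mulrC 'X).
by rewrite rmorph_nat.
Qed.

Lemma fused_det_deriv i j : fused_det^`M(ixX i j) =
  s%:MP * fused_det^`M(ixA i j) + t%:MP * fused_det^`M(ixB i j) +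
  (s%:MP * t%:MP) * \sum_k fused_det^`M(ixB k j)^`M(ixA i k).
Proof.
pose C := P *m R + Z.
have tw : twisted i j (\det C) = ((s%:MP * t%:MP))%:P * ('X * cofactor C i j).
  rewrite (derivation_det (der_twisted _ _)) (bigD1 i) //= [X in _ + X]big1 ?addr0.
    rewrite det_rowrep (bigD1 j) //= big1 ?addr0 => [|b /negPf bj].
      by rewrite twisted_entry !eqxx mulr1 -mulrA.
    by rewrite twisted_entry bj andbF mulr0 mul0r.
  move=> p /negPf pi; rewrite det_rowrep big1 // => b _.
  by rewrite twisted_entry pi mulr0 mul0r.
have cap : \sum_k dd (ixA i k) (dd (ixB k j) (\det C)) =
    cofactor C i j + 'X * (cofactor C i j)^`().
  apply: (@capelli_det {poly Q} n (fun i k => dd (ixA i k)) (fun k j => dd (ixB k j))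
    (fun p => 'X * p^`())) => //; first exact: derivation_euler.
  - by move=> a k b c; rewrite PE dd_entry !varE /= mulr0 addr0 rmorph_nat.
  - by move=> a k b c; rewrite RE dd_entry !varE /= mulr0 addr0.
  - by move=> a k b c; rewrite dd_Z !varE /= !mulr0.
  - by move=> a k b c; rewrite PE dd_entry !varE /= mulr0 addr0.
  - by move=> a k b c; rewrite RE dd_entry !varE /= mulr0 addr0 rmorph_nat.
  - by move=> a k b c; rewrite dd_Z !varE /= !mulr0.
  - by move=> a b; rewrite PE derivC mulr0.
  - by move=> a b; rewrite RE derivC mulr0.
  by move=> a b; rewrite ZE derivM derivX derivC mulr0 addr0 mul1r.
have lap c p : laplace (dd c p) = (laplace p)^`M(c).
  by apply: laplace_derivation; apply: derivation_mderiv.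
have : laplace (dd (ixX i j) (\det C)) =
    laplace (twisted i j (\det C) + (s%:MP)%:P * dd (ixA i j) (\det C)
             + (t%:MP)%:P * dd (ixB i j) (\det C)).
  by congr laplace; rewrite /twisted; ring.
rewrite tw !laplaceD !laplaceCM laplaceXM -cap laplace_sum !lap => ->.
rewrite -addrA addrC; congr (_ + _ * _); apply: eq_bigr => k _.
by rewrite !lap.
Qed.

End FusedDeterminant.

Definition psub (K : fieldType) n M (g : 'M[{mpoly K[M]}]_n) :
  {mpoly K[n * n]} -> {mpoly K[M]} := msubst (fun k => mxvec g 0 k).

HB.instance Definition _ (K : fieldType) n M (g : 'M[{mpoly K[M]}]_n) :=
  GRing.Linear.on (psub g).
HB.instance Definition _ (K : fieldType) n M (g : 'M[{mpoly K[M]}]_n) :=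
  GRing.RMorphism.on (psub g).

Lemma psubXM (K : fieldType) n M (g : 'M[{mpoly K[M]}]_n) i j f :
  psub g ('X_(mxvec_index i j) * f) = g i j * psub g f.
Proof. by rewrite rmorphM /= /psub msubstX mxvecE. Qed.

Lemma psub_intertwine (K : fieldType) n M M' (T : {linear {mpoly K[M]} -> {mpoly K[M']}})
    (g : 'M[{mpoly K[M]}]_n) (g' : 'M[{mpoly K[M']}]_n) :
  (forall i j F, T (diffop (g i j) F) = diffop (g' i j) (T F)) ->
  forall f F, T (diffop (psub g f) F) = diffop (psub g' f) (T F).
Proof.
move=> Tg; apply: diffop_intertwine => k F.
by case/mxvec_indexP: k => i j; rewrite !mxvecE.
Qed.

Lemma psub_diffop_eq (K : fieldType) n M (g g' : 'M[{mpoly K[M]}]_n) F :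
  (forall i j, diffop (g i j) F = diffop (g' i j) F) ->
  forall f, diffop (psub g f) F = diffop (psub g' f) F.
Proof.
move=> eq_g; apply: diffop_subst_eq => k.
by case/mxvec_indexP: k => i j; rewrite !mxvecE.
Qed.

Lemma meval_psub (K : fieldType) n M (g : 'M[{mpoly K[M]}]_n) f v :
  (psub g f).@[v] = f.@[fun k => mxvec (map_mx (meval v) g) 0 k].
Proof.
rewrite /psub meval_msubst; apply: meval_eq => k.
by case/mxvec_indexP: k => i j; rewrite !mxvecE mxE.
Qed.

Lemma mderiv_msubst_scaled (K : fieldType) N M (g : 'I_N -> {mpoly K[M]}) c c' (a : K) F :
  (forall k, (g k)^`M(c) = (a *+ (k == c'))%:MP) ->
  (msubst g F)^`M(c) = a *: msubst g F^`M(c').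
Proof.
move=> dg; rewrite mderiv_subst (bigD1 c') //= dg eqxx mulr1n big1 ?addr0 => [|k /negPf kc].
  by rewrite mulrC mul_mpolyC.
by rewrite dg kc mulr0n mpolyC0 mulr0.
Qed.

Lemma diffop_affine (K : fieldType) N (b : bool) (s : K) i (F : {mpoly K[N]}) :
  diffop (b%:R + s%:MP * 'X_i) F = F *+ b + s *: F^`M(i).
Proof.
rewrite diffopDl mul_mpolyC diffopZl diffopX; congr (_ + _).
by case: b; rewrite ?diffop1 // mulr0n -mpolyC0 diffopC scale0r.
Qed.

Lemma diffop_CM (K : fieldType) N (c : K) (p F : {mpoly K[N]}) :
  diffop (c%:MP * p) F = c%:MP * diffop p F.
Proof. by rewrite mul_mpolyC diffopZl mul_mpolyC. Qed.

Definition oneD (K : fieldType) n M (s : K) (v : 'M[{mpoly K[M]}]_n) : 'M_n :=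
  1%:M + s%:MP *: v.

Lemma oneDE (K : fieldType) n M (s : K) (v : 'M[{mpoly K[M]}]_n) i j :
  oneD s v i j = (i == j)%:R + s%:MP * v i j.
Proof. by rewrite 3!mxE. Qed.

Section StarProduct.
Variables (K : numFieldType) (n : nat).
Local Notation N := (n * n)%N.
Local Notation Q := {mpoly K[N + N + N]}.
Local Notation H := (genericmx K n).
Local Notation A := (varA K n).
Local Notation B := (varB K n).
Local Notation X := (varX K n).

Let varE := (mderivXU, eq_lshift, eq_rshift, eq_lrshift, eq_rlshift, mxvec_index_eq).

Definition ptAB (A0 B0 : 'M[K]_n) (k : 'I_(N + N + N)) : K :=
  match split k with
  | inl l => match split l with inl i => mxvec A0 0 i | inr i => mxvec B0 0 i end
  | inr _ => 0
  end.

Definition specAB (A0 B0 : 'M[K]_n) : Q -> {mpoly K[N]} :=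
  msubst (fun k => match split k with
    | inl l => match split l with
               | inl i => (mxvec A0 0 i)%:MP | inr i => (mxvec B0 0 i)%:MP end
    | inr i => 'X_i
    end).

Definition killX : Q -> Q :=
  msubst (fun k => if split k is inl _ then 'X_k else 0).

Lemma split_lshift m1 m2 (i : 'I_m1) : split (lshift m2 i) = inl i.
Proof. exact: (unsplitK (inl i)). Qed.
Lemma split_rshift m1 m2 (i : 'I_m2) : split (rshift m1 i) = inr i.
Proof. exact: (unsplitK (inr i)). Qed.

Let splE := (split_lshift, split_rshift).

Variant is_ix3 : 'I_(N + N + N) -> Type :=
  | IsA i j : is_ix3 (ixA i j)
  | IsB i j : is_ix3 (ixB i j)
  | IsX i j : is_ix3 (ixX i j).

Lemma ix3P k : is_ix3 k.
Proof.
rewrite -[k]splitK; case: (split k) => l /=; last first.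
  by case/mxvec_indexP: l => i j; exact: IsX.
rewrite -[l]splitK; case: (split l) => m /=; case/mxvec_indexP: m => i j.
  exact: IsA.
exact: IsB.
Qed.

Lemma specAB_A A0 B0 i j : specAB A0 B0 (A i j) = (A0 i j)%:MP.
Proof. by rewrite mxE /specAB msubstX !splE mxvecE. Qed.
Lemma specAB_B A0 B0 i j : specAB A0 B0 (B i j) = (B0 i j)%:MP.
Proof. by rewrite mxE /specAB msubstX !splE mxvecE. Qed.
Lemma specAB_X A0 B0 i j : specAB A0 B0 (X i j) = H i j.
Proof. by rewrite !mxE /specAB msubstX !splE. Qed.
Lemma killX_A i j : killX (A i j) = A i j.
Proof. by rewrite mxE /killX msubstX !splE. Qed.
Lemma killX_B i j : killX (B i j) = B i j.
Proof. by rewrite mxE /killX msubstX !splE. Qed.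
Lemma killX_X i j : killX (X i j) = 0.
Proof. by rewrite mxE /killX msubstX !splE. Qed.

Lemma meval_specAB A0 B0 p : (specAB A0 B0 p).@[fun=> 0] = p.@[ptAB A0 B0].
Proof.
rewrite /specAB meval_msubst; apply: meval_eq => k.
by case: (ix3P k) => i j; rewrite /ptAB !splE ?mevalC ?mevalXU.
Qed.

Lemma meval_killX A0 B0 p : (killX p).@[ptAB A0 B0] = p.@[ptAB A0 B0].
Proof.
rewrite /killX meval_msubst; apply: meval_eq => k.
by case: (ix3P k) => i j; rewrite !splE ?mevalXU // meval0 /ptAB !splE.
Qed.

Lemma specAB_deriv A0 B0 i j p :
  specAB A0 B0 p^`M(ixX i j) = (specAB A0 B0 p)^`M(mxvec_index i j).
Proof.
rewrite /specAB (@mderiv_msubst_scaled _ _ _ _ _ (ixX i j) 1) ?scale1r // => k.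
by case: (ix3P k) => a b; rewrite !splE ?mderivC ?varE // ?mulr0n ?mpolyC0 // mpolyCMn.
Qed.

Lemma killX_derivA i j p : killX p^`M(ixA i j) = (killX p)^`M(ixA i j).
Proof.
rewrite /killX (@mderiv_msubst_scaled _ _ _ _ _ (ixA i j) 1) ?scale1r // => k.
by case: (ix3P k) => a b; rewrite !splE ?mderiv0 ?varE // ?mulr0n ?mpolyC0 // mpolyCMn.
Qed.

Lemma killX_derivB i j p : killX p^`M(ixB i j) = (killX p)^`M(ixB i j).
Proof.
rewrite /killX (@mderiv_msubst_scaled _ _ _ _ _ (ixB i j) 1) ?scale1r // => k.
by case: (ix3P k) => a b; rewrite !splE ?mderiv0 ?varE // ?mulr0n ?mpolyC0 // mpolyCMn.
Qed.

HB.instance Definition _ A0 B0 := GRing.Linear.on (specAB A0 B0).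
HB.instance Definition _ A0 B0 := GRing.RMorphism.on (specAB A0 B0).
HB.instance Definition _ := GRing.Linear.on killX.
HB.instance Definition _ := GRing.RMorphism.on killX.

Variables s t : K.

Local Notation gA := (oneD s A).
Local Notation gB := (oneD t B).

Let gAE i j : gA i j = (i == j)%:R + s%:MP * 'X_(ixA i j).
Proof. by rewrite oneDE mxE. Qed.
Let gBE i j : gB i j = (i == j)%:R + t%:MP * 'X_(ixB i j).
Proof. by rewrite oneDE mxE. Qed.

Let gABE i j : (gA *m gB) i j = (i == j)%:R + (s%:MP * A i j + t%:MP * B i j +
  (s%:MP * t%:MP) * \sum_k (A i k * B k j)).
Proof.
have -> : gA *m gB = 1%:M + (s%:MP *: A + t%:MP *: B + (s%:MP * t%:MP) *: (A *m B)).
  rewrite /oneD mulmxDl mul1mx mulmxDr mulmx1 -scalemxAr -scalemxAl scalerA (mulrC t%:MP).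
  move: (1%:M : 'M[Q]_n) (_ *: A) (_ *: B) (_ *: (A *m B)) => c1 c2 c3 c4.
  by rewrite -!addrA; congr (_ + _); rewrite addrCA.
rewrite mxE; congr (_ + _); first by rewrite mxE.
rewrite mxE; congr (_ + _); first by rewrite mxE; congr (_ + _); rewrite mxE.
by rewrite mxE; congr (_ * _); rewrite mxE.
Qed.

Lemma fused_det_product f :
  diffop (psub (gA *m gB) f) (fused_det n s t) = diffop (psub (oneD 1 X) f) (fused_det n s t).
Proof.
apply: psub_diffop_eq => i j; rewrite gABE oneDE mul1r [X i j]mxE.
rewrite diffopDl [in RHS]diffopDl diffopX fused_det_deriv; congr (_ + _).
rewrite diffopDl diffopDl -mulrA 4!diffop_CM diffop_suml mulrA; congr (_ + _ + _ * _).
- by rewrite mxE diffopX.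
- by rewrite mxE diffopX.
by apply: eq_bigr => k _; rewrite diffopM 2!mxE !diffopX.
Qed.

Let killX_gAB i j F : killX (diffop ((gA *m gB) i j) F) = diffop ((gA *m gB) i j) (killX F).
Proof.
have killX_A1 k G : killX (diffop (gA i k) G) = diffop (gA i k) (killX G).
  by rewrite gAE !diffop_affine linearD linearZ raddfMn /= killX_derivA.
have killX_B1 k G : killX (diffop (gB k j) G) = diffop (gB k j) (killX G).
  by rewrite gBE !diffop_affine linearD linearZ raddfMn /= killX_derivB.
rewrite mxE !diffop_suml raddf_sum; apply: eq_bigr => k _ /=.
by rewrite !diffopM killX_A1 killX_B1.
Qed.

Lemma killX_fused_det : killX (fused_det n s t) = \det A * \det B.
Proof.
have kX : map_mx killX X = 0 by apply/matrixP => i j; rewrite mxE killX_X mxE.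
have kA : map_mx killX A = A by apply/matrixP => i j; rewrite mxE killX_A.
have kB : map_mx killX B = B by apply/matrixP => i j; rewrite mxE killX_B.
by rewrite rmorph_fused kX kA kB fused0.
Qed.

Lemma star_value f A0 B0 :
  (diffop (psub (gA *m gB) f) (\det A * \det B)).@[ptAB A0 B0] =
  (diffop (psub (oneD 1 H) f) (specAB A0 B0 (fused_det n s t))).@[fun=> 0].
Proof.
rewrite -killX_fused_det -(psub_intertwine (T := killX) killX_gAB) meval_killX.
rewrite fused_det_product -meval_specAB; congr (meval _ _).
apply: psub_intertwine => i j F.
rewrite !oneDE [X i j]mxE [H i j]mxE.
by rewrite !diffop_affine linearD linearZ raddfMn /= specAB_deriv.
Qed.

End StarProduct.


Lemma specAB_fused_det_sym (K : numFieldType) n (s t c : K) (A0 B0 : 'M[K]_n) :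
  s != t -> A0 - B0 = c%:M ->
  specAB A0 B0 (fused_det n s t) = specAB B0 A0 (fused_det n t s).
Proof.
move=> ne_st AB_c.
have specE A1 B1 u v : specAB A1 B1 (fused_det n u v) =
    fused (map_mx (@mpolyC _ K) A1) (map_mx (@mpolyC _ K) B1) (genericmx K n) u%:MP v%:MP.
  have eA : map_mx (specAB A1 B1) (varA K n) = map_mx (@mpolyC _ K) A1.
    by apply/matrixP => i j; rewrite mxE specAB_A mxE.
  have eB : map_mx (specAB A1 B1) (varB K n) = map_mx (@mpolyC _ K) B1.
    by apply/matrixP => i j; rewrite mxE specAB_B mxE.
  have eX : map_mx (specAB A1 B1) (varX K n) = genericmx K n.
    by apply/matrixP => i j; rewrite mxE specAB_X.
  by rewrite rmorph_fused eA eB eX /= /specAB !msubstC.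
rewrite !specE; apply: (@fused_sym _ _ _ _ _ _ _ c%:MP (s - t)^-1%:MP).
  by rewrite -mpolyCB -mpolyCM divff // subr_eq0.
apply/matrixP => i j; have := congr1 (fun M : 'M_n => M i j) AB_c.
by rewrite !mxE -mpolyCB => ->; rewrite mpolyCMn.
Qed.

(** * Commutation of the N(s,z) *)

Lemma diffop_psub_mul (K : fieldType) n M (g : 'M[{mpoly K[M]}]_n) c :
  (forall i j F, diffop (g i j) (c * F) = c * diffop (g i j) F) ->
  forall f F, diffop (psub g f) (c * F) = c * diffop (psub g f) F.
Proof.
move=> gc; elim/mpoly_ind_XM => [a|p q IHp IHq|k p IH] F; rewrite /psub.
- by rewrite msubstC !diffopC -scalerAr.
- by rewrite msubstD !diffopDl IHp IHq mulrDr.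
rewrite msubstM msubstX !diffopM IH.
by case/mxvec_indexP: k => i j; rewrite mxvecE gc.
Qed.

Section ProductSplitting.
Variables (K : numFieldType) (n : nat).
Local Notation A := (varA K n).
Local Notation B := (varB K n).

Let varE := (mxE, mderivXU, eq_lshift, eq_rshift, eq_lrshift, eq_rlshift, mxvec_index_eq).

Lemma mderiv_det0 M (g : 'M[{mpoly K[M]}]_n) c :
  (forall i j, (g i j)^`M(c) = 0) -> (\det g)^`M(c) = 0.
Proof.
move=> g0; rewrite (derivation_det (@derivation_mderiv K M c)) big1 // => p _.
by rewrite det_rowrep big1 // => j _; rewrite g0 mul0r.
Qed.

Lemma diffop_det_split (s t : K) f g :
  diffop (psub (oneD s A) f) (\det A) * diffop (psub (oneD t B) g) (\det B)
  = diffop (psub (oneD s A) f * psub (oneD t B) g) (\det A * \det B).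
Proof.
have gAE i j : (oneD s A) i j = (i == j)%:R + s%:MP * 'X_(ixA i j) by rewrite oneDE mxE.
have gBE i j : (oneD t B) i j = (i == j)%:R + t%:MP * 'X_(ixB i j) by rewrite oneDE mxE.
have dAB i j : (\det B)^`M(ixA i j) = 0 by apply: mderiv_det0 => a b; rewrite !varE.
have dBA i j : (\det A)^`M(ixB i j) = 0 by apply: mderiv_det0 => a b; rewrite !varE.
have dmul c h F : h^`M(c) = 0 -> (h * F)^`M(c) = h * F^`M(c) :> {mpoly K[n * n + n * n + n * n]}.
  by move=> h0; rewrite mderivM h0 mul0r add0r.
rewrite diffopM [in RHS]diffop_psub_mul => [|i j F]; last first.
  by rewrite gBE !diffop_affine dmul // mulrDr mulrnAr scalerAr.
set E := diffop _ (\det B).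
have dE i j : E^`M(ixA i j) = 0 by rewrite mderiv_diffop dAB linear0.
transitivity (E * diffop (psub (oneD s A) f) (\det A)); first exact: mulrC.
rewrite [\det A * E]mulrC; apply/esym/diffop_psub_mul => i j F.
by rewrite gAE !diffop_affine dmul // mulrDr mulrnAr scalerAr.
Qed.

End ProductSplitting.

Section RepresentationPolynomials.
Variables (K : numFieldType) (n m : nat) (rho : polyRep K n m).
Local Notation R := (rep_coef rho).

Lemma map_mx_meval_evalmx M (g : 'M[{mpoly K[M]}]_n) v :
  map_mx (meval v) (map_mx (psub g) R) = evalmx R (map_mx (meval v) g).
Proof. by apply/matrixP => i j; rewrite !mxE meval_psub. Qed.

Lemma psub_rep_mul M (g h : 'M[{mpoly K[M]}]_n) : \det g != 0 -> \det h != 0 ->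
  map_mx (psub g) R *m map_mx (psub h) R = map_mx (psub (g *m h)) R.
Proof.
move=> g0 h0; apply/matrixP => i j; apply: (mulfI (mulf_neq0 g0 h0)).
apply: eq_meval => v; rewrite !mevalM.
rewrite -!det_map_mx.
have [g1|] := boolP (\det (map_mx (meval v) g) == 0); first by rewrite (eqP g1) !mul0r.
have [h1|] := boolP (\det (map_mx (meval v) h) == 0).
  by rewrite (eqP h1) mulr0 !mul0r.
rewrite -!unitfE -!unitmxE => uh ug; congr (_ * _).
have /matrixP/(_ i j) := rep_mul rho ug uh.
rewrite -map_mxM /= -!map_mx_meval_evalmx -map_mxM mxE => ->.
by rewrite [RHS]mxE.
Qed.

Lemma psub_rep_mulE M (g h : 'M[{mpoly K[M]}]_n) i j :
  \det g != 0 -> \det h != 0 ->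
  \sum_k psub g (R i k) * psub h (R k j) = psub (g *m h) (R i j).
Proof.
move=> g0 h0; have /matrixP/(_ i j) := psub_rep_mul g0 h0.
rewrite mxE [in RHS]mxE => <-.
apply: eq_bigr => k _.
have e1 : map_mx (psub g) R i k = psub g (R i k) by rewrite mxE.
have e2 : map_mx (psub h) R k j = psub h (R k j) by rewrite mxE.
by rewrite e1 e2.
Qed.

End RepresentationPolynomials.

Section Generators.
Variables (K : numFieldType) (n m : nat) (rho : polyRep K n m).
Local Notation R := (rep_coef rho).
Local Notation H := (genericmx K n).
Local Notation A := (varA K n).
Local Notation B := (varB K n).

Let varE := (mderivXU, eq_lshift, eq_rshift, eq_lrshift, eq_rlshift, mxvec_index_eq).

Definition chi (z : K) : {mpoly K[n * n]} := \det (z%:MP%:M - H).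

(* N(s, z); the transpose occurs because the Kirillov-Wei operator pairs d/dy_ji
   with E_ij. *)
Definition normal_gen (s z : K) : 'M[{mpoly K[n * n]}]_m :=
  map_mx (fun f => diffop (psub (oneD s H^T) f) (chi z)) R.

Lemma reflected_value M (v : 'M[{mpoly K[M]}]_n) (ix : 'I_n -> 'I_n -> 'I_M)
    (s z : K) f (Y0 : 'M[K]_n) w :
  (forall i j, v i j = 'X_(ix i j)) ->
  (forall i j a b, (ix a b == ix i j) = (a == i) && (b == j)) ->
  (forall i j, (v i j).@[w] = (z%:M - Y0^T) i j) ->
  (diffop (psub (oneD s H^T) f) (chi z)).@[fun k => mxvec Y0 0 k] =
  (diffop (psub (oneD (- s) v) f) (\det v)).@[w].
Proof.
move=> vE ixE vw.
pose r := fun k => mxvec (z%:MP%:M - v^T) 0 k.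
have rX i j : msubst r (H i j) = (z%:MP%:M - v^T) i j by rewrite mxE msubstX /r mxvecE.
have chi_r : msubst r (chi z) = \det v.
  rewrite /chi -det_map_mx -[RHS]det_tr; congr (\det _); apply/matrixP => i j.
  rewrite mxE [(_ - H) i j]mxE [(- H) i j]mxE rmorphB /= rX.
  rewrite 2![in LHS]mxE rmorphMn /= msubstC !mxE.
  by rewrite opprB addrC subrK.
rewrite -chi_r -(@psub_intertwine _ _ _ _ (msubst r) (oneD s H^T)).
  rewrite meval_msubst; apply: meval_eq => k; case/mxvec_indexP: k => i j.
  rewrite /r !mxvecE 4!mxE mevalB mevalMn mevalC vw !mxE.
  by rewrite [j == i]eq_sym opprB addrC subrK.
move=> i j F.
rewrite !oneDE vE [H^T i j]mxE [H j i]mxE.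
rewrite !diffop_affine linearD linearZ raddfMn /=; congr (_ + _).
rewrite (@mderiv_msubst_scaled _ _ _ _ _ (mxvec_index j i) (-1)) ?scalerA ?mulrN1 ?opprK //.
move=> k; case/mxvec_indexP: k => a b; rewrite /r mxvecE 4!mxE vE mderivB.
rewrite mderivXU ixE mxvec_index_eq andbC mderivMn mderivC mul0rn sub0r.
by case: (_ && _); rewrite ?mulr1n ?mpolyCN ?mpolyC1 // mulr0n oppr0 mpolyC0.
Qed.

Lemma det_1D_neq0 M (v : 'M[{mpoly K[M]}]_n) (s : K) w :
  (forall i j, (v i j).@[w] = 0) -> \det (oneD s v) != 0.
Proof.
move=> vw; apply/eqP => /(congr1 (meval w)); rewrite meval0 -det_map_mx.
have -> : map_mx (meval w) (oneD s v) = 1%:M.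
  apply/matrixP => i j; rewrite mxE oneDE mevalD mevalM vw mulr0 addr0.
  by rewrite rmorph_nat mxE.
by move/eqP; rewrite det1 oner_eq0.
Qed.

Lemma meval_ptA A0 B0 i j : (A i j).@[ptAB A0 B0] = A0 i j.
Proof. by rewrite -meval_specAB specAB_A mevalC. Qed.
Lemma meval_ptB A0 B0 i j : (B i j).@[ptAB A0 B0] = B0 i j.
Proof. by rewrite -meval_specAB specAB_B mevalC. Qed.

Lemma normal_gen_mul_value s t z w Y0 i j :
  ((normal_gen s z *m normal_gen t w) i j).@[fun k => mxvec Y0 0 k] =
  (diffop (psub (oneD 1 H) (R i j))
     (specAB (z%:M - Y0^T) (w%:M - Y0^T) (fused_det n (- s) (- t)))).@[fun=> 0].
Proof.
pose A0 := z%:M - Y0^T; pose B0 := w%:M - Y0^T.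
rewrite -star_value -/A0 -/B0 mxE raddf_sum /=.
transitivity (\sum_k (diffop (psub (oneD (- s) A) (R i k) *
    psub (oneD (- t) B) (R k j)) (\det A * \det B)).@[ptAB A0 B0]).
  apply: eq_bigr => k _; rewrite -diffop_det_split !mevalM; congr (_ * _); rewrite mxE.
    apply: (reflected_value (ix := @ixA n)).
    - by move=> a b; rewrite mxE.
    - by move=> a b c d; rewrite !varE.
    by move=> a b; rewrite meval_ptA.
  apply: (reflected_value (ix := @ixB n)).
  - by move=> a b; rewrite mxE.
  - by move=> a b c d; rewrite !varE.
  by move=> a b; rewrite meval_ptB.
rewrite -raddf_sum -diffop_suml /=; congr (meval _ (diffop _ _)).
have zA a b : (A a b).@[ptAB 0 0] = 0 by rewrite meval_ptA mxE.
have zB a b : (B a b).@[ptAB 0 0] = 0 by rewrite meval_ptB mxE.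
by apply: psub_rep_mulE; [exact: det_1D_neq0 zA | exact: det_1D_neq0 zB].
Qed.

Lemma normal_gen_comm s t z w : s != t ->
  normal_gen s z *m normal_gen t w = normal_gen t w *m normal_gen s z.
Proof.
move=> ne_st; apply/matrixP => i j; apply: eq_meval => v.
pose Y0 : 'M[K]_n := vec_mx (\row_k v k).
have val a b c d : ((normal_gen a c *m normal_gen b d) i j).@[v] =
    (diffop (psub (oneD 1 H) (R i j))
       (specAB (c%:M - Y0^T) (d%:M - Y0^T) (fused_det n (- a) (- b)))).@[fun=> 0].
  by rewrite -normal_gen_mul_value; apply: meval_eq => k; rewrite vec_mxK mxE.
rewrite [LHS]val [RHS]val.
rewrite (@specAB_fused_det_sym _ _ _ _ (z - w)) ?eqr_opp //.
by rewrite opprB addrA subrK raddfB.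
Qed.

End Generators.

(** * Infinitesimal multiplicativity of the representation *)

Section DegreeWeights.
Variables (K : fieldType) (N : nat).
Implicit Types (f g : {mpoly K[N]}) (phi psi : nat -> K).

Definition wdeg phi f : {mpoly K[N]} :=
  \sum_(m <- msupp f) (phi (mdeg m) * f@_m) *: 'X_[m].

Lemma mcoeff_wdeg phi f m : (wdeg phi f)@_m = phi (mdeg m) * f@_m.
Proof.
rewrite /wdeg raddf_sum /=; have [mf|mf] := boolP (m \in msupp f).
  rewrite (bigD1_seq m) ?msupp_uniq //= mcoeffZ mcoeffX eqxx mulr1 big1 ?addr0 //.
  by move=> k /negPf km; rewrite mcoeffZ mcoeffX km mulr0.
rewrite (memN_msupp_eq0 mf) mulr0 big_seq big1 // => k kf.
rewrite mcoeffZ mcoeffX; case: eqP => [km|]; last by rewrite mulr0.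
by rewrite -km kf in mf.
Qed.

Lemma wdeg_linear phi : linear (wdeg phi).
Proof.
move=> c f g; apply/mpolyP => m.
rewrite mcoeffD mcoeffZ !mcoeff_wdeg mcoeffD mcoeffZ; ring.
Qed.

HB.instance Definition _ phi :=
  GRing.isLinear.Build K {mpoly K[N]} {mpoly K[N]} _ (wdeg phi) (wdeg_linear phi).

Lemma wdegX phi m : wdeg phi 'X_[m] = phi (mdeg m) *: 'X_[m].
Proof.
apply/mpolyP => k; rewrite mcoeff_wdeg mcoeffZ mcoeffX.
by case: eqP => [->|]; rewrite ?mulr0.
Qed.

Lemma mderiv_wdeg phi i f :
  (wdeg (fun q => phi q.-1) f)^`M(i) = wdeg phi (f^`M(i)).
Proof.
apply/mpolyP => m; rewrite mcoeff_deriv !mcoeff_wdeg mcoeff_deriv.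
by rewrite mdegD mdeg1 addn1 mulrnAr.
Qed.

Lemma wdeg_mulX phi i f : wdeg phi ('X_i * f) = 'X_i * wdeg (fun q => phi q.+1) f.
Proof.
elim/mpolyind: f => [|c m f _ _ IH]; first by rewrite mulr0 !linear0 mulr0.
rewrite mulrDr !linearD /= mulrDr IH; congr (_ + _).
rewrite -scalerAr !linearZ /= -mpolyXD !wdegX -!scalerAr -mpolyXD.
by rewrite mdegD mdeg1 add1n.
Qed.

Lemma wdeg_mulX_deriv phi i j f :
  wdeg phi ('X_i * f^`M(j)) = 'X_i * (wdeg phi f)^`M(j).
Proof.
rewrite wdeg_mulX; congr (_ * _); apply/mpolyP => m.
by rewrite mcoeff_deriv !mcoeff_wdeg mcoeff_deriv mdegD mdeg1 addn1 mulrnAr.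
Qed.

Lemma euler_mderiv f : \sum_i 'X_i * f^`M(i) = wdeg (fun q => q%:R) f.
Proof.
elim/mpolyind: f => [|c m f _ _ IH].
  by rewrite linear0 big1 // => i _; rewrite linear0 mulr0.
rewrite linearD linearZ /= -IH wdegX.
under eq_bigr do rewrite linearD /= mulrDr.
rewrite big_split /=; congr (_ + _).
rewrite mdegE natr_sum scaler_suml scaler_sumr; apply: eq_bigr => i _.
rewrite linearZ /= mderivX -scalerAr; congr (_ *: _); rewrite -scalerAr -mpolyXD.
have [->|mi] := eqVneq (m i) 0%N; first by rewrite !scale0r.
congr (_ *: 'X_[_]); rewrite addmC submK //; apply/mnm_lepP => j; rewrite mnm1E.
by case: eqP => [<-|//]; rewrite lt0n.
Qed.

Lemma euler_wdeg phi f :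
  \sum_i 'X_i * (wdeg phi f)^`M(i) = wdeg (fun q => q%:R * phi q) f.
Proof.
rewrite euler_mderiv; apply/mpolyP => m.
by rewrite !mcoeff_wdeg mulrA.
Qed.

Lemma wdeg_exp s f : wdeg (fun q => s ^+ q) f = msubst (fun i => s%:MP * 'X_i) f.
Proof.
elim/mpolyind: f => [|c m f _ _ IH]; first by rewrite !linear0.
rewrite !linearD /= IH; congr (_ + _).
rewrite !linearZ /= wdegX; congr (_ *: _); rewrite mpolyXE_id rmorph_prod /=.
rewrite mdegE -prodrXr -mul_mpolyC rmorph_prod -big_split; apply: eq_bigr => i _ /=.
by rewrite [RHS]rmorphXn /= msubstX exprMn (rmorphXn (@mpolyC N K)).
Qed.

Lemma wdeg_delta0 f : wdeg (fun q => (q == 0)%:R) f = (f@_0)%:MP.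
Proof.
apply/mpolyP => m; rewrite mcoeff_wdeg mcoeffC mdeg_eq0 mulrC.
by case: eqP => [->|_]; rewrite ?mulr0.
Qed.

End DegreeWeights.

Lemma mderiv_psub (K : fieldType) n M (g : 'M[{mpoly K[M]}]_n) c f :
  (psub g f)^`M(c) =
  \sum_k \sum_l psub g f^`M(mxvec_index k l) * (g k l)^`M(c).
Proof.
rewrite /psub mderiv_subst (reindex (uncurry (@mxvec_index n n))) /=.
  rewrite pair_bigA; apply: eq_bigr => -[k l] _ /=; by rewrite mxvecE.
exact: curry_mxvec_bij.
Qed.

Lemma msubst_psub (K : fieldType) n M M' (g : 'M[{mpoly K[M]}]_n)
    (h : 'I_M -> {mpoly K[M']}) f :
  msubst h (psub g f) = psub (map_mx (msubst h) g) f.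
Proof.
rewrite /psub msubst_comp; apply: eq_msubst => k.
by case/mxvec_indexP: k => i j; rewrite !mxvecE mxE.
Qed.

Lemma psub_const (K : fieldType) n M (g : 'M[K]_n) f :
  psub (map_mx (@mpolyC M K) g) f = (f.@[fun k => mxvec g 0 k])%:MP.
Proof.
elim/mpoly_ind_XM: f => [c|p q IHp IHq|k p IH]; rewrite /psub.
- by rewrite msubstC mevalC.
- by rewrite msubstD mevalD mpolyCD -IHp -IHq.
rewrite msubstM msubstX mevalM mevalXU mpolyCM -IH.
by case/mxvec_indexP: k => i j; rewrite !mxvecE mxE.
Qed.

Lemma psub_generic (K : fieldType) n f : psub (genericmx K n) f = f.
Proof.
rewrite -[RHS]msubst_id; apply: eq_msubst => k.
by case/mxvec_indexP: k => i j; rewrite mxvecE mxE.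
Qed.

Section Infinitesimal.
Variables (K : numFieldType) (n m : nat) (rho : polyRep K n m).
Local Notation R := (rep_coef rho).
Local Notation H := (genericmx K n).
Local Notation N := (n * n)%N.

Definition lie_unit (i j : 'I_n) : 'M[K]_m := evalmx (dermx i j R) 1%:M.

Lemma lie_rep_delta i j : lie_rep rho (delta_mx i j) = lie_unit i j.
Proof.
rewrite /lie_rep (bigD1 i) //= [X in _ + X]big1 ?addr0 => [|k /negPf ki]; last first.
  by rewrite big1 // => l _; rewrite mxE ki scale0r.
rewrite (bigD1 j) //= mxE !eqxx scale1r big1 ?addr0 // => l /negPf lj.
by rewrite mxE lj andbF scale0r.
Qed.

Let varE := (mderivXU, eq_lshift, eq_rshift, eq_lrshift, eq_rlshift, mxvec_index_eq).

(* Differentiating R(gh) = R(g) R(h) in h at h = 1. *)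
Lemma rep_infinitesimal (i j : 'I_n) x z :
  \sum_y lie_unit i j y z *: R x y =
  \sum_k 'X_(mxvec_index k i) * (R x z)^`M(mxvec_index k j).
Proof.
pose a : 'M[{mpoly K[N + N]}]_n := \matrix_(k, l) 'X_(lshift N (mxvec_index k l)).
pose b : 'M[{mpoly K[N + N]}]_n := \matrix_(k, l) 'X_(rshift N (mxvec_index k l)).
pose tau : 'I_(N + N) -> {mpoly K[N]} :=
  fun k => match split k with inl l => 'X_l | inr l => mxvec 1%:M 0 l end.
have tau_a : map_mx (msubst tau) a = H.
  by apply/matrixP => k l; rewrite !mxE msubstX /tau split_lshift.
have tau_b : map_mx (msubst tau) b = 1%:M.
  by apply/matrixP => k l; rewrite 2!mxE msubstX /tau split_rshift mxvecE.
pose w k := match split k with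
  | inl l => mxvec (1%:M : 'M[K]_n) 0 l | inr l => mxvec (1%:M : 'M[K]_n) 0 l end.
have det_neq0 c : map_mx (meval w) c = 1%:M -> \det c != 0 :> {mpoly K[N + N]}.
  move=> c1; apply/eqP => /(congr1 (meval w)) /eqP; rewrite -det_map_mx c1.
  by rewrite det1 meval0 oner_eq0.
have a0 : \det a != 0.
  apply: det_neq0; apply/matrixP => k l.
  by rewrite [LHS]mxE [a _ _]mxE mevalXU /w split_lshift mxvecE.
have b0 : \det b != 0.
  apply: det_neq0; apply/matrixP => k l.
  by rewrite [LHS]mxE [b _ _]mxE mevalXU /w split_rshift mxvecE.
have E : msubst tau (\sum_y (psub a (R x y) * psub b (R y z)))^`M(rshift N (mxvec_index i j)) =
    \sum_k msubst tau (\sum_l psub (a *m b) (R x z)^`M(mxvec_index k l) *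
      ((a *m b) k l)^`M(rshift N (mxvec_index i j))).
  by rewrite psub_rep_mulE // mderiv_psub linear_sum.
have da k l c d : (a k l)^`M(rshift N (mxvec_index c d)) = 0 by rewrite mxE !varE.
have db k l c d : (b k l)^`M(rshift N (mxvec_index c d)) = ((k == c) && (l == d))%:R.
  by rewrite mxE !varE.
transitivity (\sum_y msubst tau (psub a (R x y) * psub b (R y z))^`M(rshift N (mxvec_index i j))).
  apply: eq_bigr => y _.
  have -> : (psub a (R x y) * psub b (R y z))^`M(rshift N (mxvec_index i j)) =
      psub a (R x y) * psub b (R y z)^`M(mxvec_index i j).
    rewrite mderivM [X in X * _ + _]mderiv_psub big1 => [|k _]; last first.
      by rewrite big1 // => l _; rewrite da mulr0.
    rewrite mul0r add0r; congr (_ * _).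
    rewrite mderiv_psub (bigD1 i) //= (bigD1 j) //= db !eqxx mulr1.
    rewrite big1 ?addr0 => [|l /negPf lj]; last by rewrite db lj andbF mulr0.
    rewrite big1 ?addr0 // => k /negPf ki; rewrite big1 // => l _.
    by rewrite db ki mulr0.
  rewrite rmorphM /= !msubst_psub tau_a tau_b.
  rewrite psub_generic; have -> : 1%:M = map_mx (@mpolyC N K) (1%:M : 'M_n).
    by apply/matrixP => k l; rewrite !mxE mpolyC_nat.
  by rewrite psub_const mulrC mul_mpolyC /lie_unit !mxE.
rewrite -linear_sum -linear_sum [LHS]E; apply: eq_bigr => k _.
have dab l : ((a *m b) k l)^`M(rshift N (mxvec_index i j)) = a k i * (l == j)%:R.
  rewrite mxE raddf_sum (bigD1 i) //= mderivM da db mul0r add0r eqxx big1 ?addr0 //.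
  by move=> c /negPf ci; rewrite mderivM da db ci mul0r mulr0 addr0.
rewrite (bigD1 j) //= big1 ?addr0 => [|l /negPf lj]; last by rewrite dab lj !mulr0.
rewrite dab eqxx mulr1 rmorphM /= msubst_psub map_mxM tau_a tau_b mulmx1 psub_generic.
by rewrite mulrC; congr (_ * _); rewrite mxE msubstX /tau split_lshift.
Qed.

Local Notation R1T := (map_mx (psub (oneD 1 H^T)) R).

Lemma mderiv_psub_oneDT f i j : (psub (oneD 1 H^T) f)^`M(mxvec_index j i) =
  psub (oneD 1 H^T) f^`M(mxvec_index i j).
Proof.
rewrite /psub (@mderiv_msubst_scaled _ _ _ _ _ (mxvec_index i j) 1) ?scale1r // => k.
case/mxvec_indexP: k => k l; rewrite mxvecE oneDE mul1r 2!mxE mderivD mderivXU.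
rewrite -mpolyC_nat mderivC add0r !mxvec_index_eq andbC.
by case: (_ && _); rewrite ?mulr1n ?mpolyC1 // mulr0n mpolyC0.
Qed.

Lemma rep_infinitesimal_shifted i j x z :
  \sum_y lie_unit i j y z *: R1T x y = (R1T x z)^`M(mxvec_index j i) +
    \sum_k 'X_(mxvec_index i k) * (R1T x z)^`M(mxvec_index j k).
Proof.
transitivity (psub (oneD 1 H^T) (\sum_y lie_unit i j y z *: R x y)).
  by rewrite linear_sum; apply: eq_bigr => y _; rewrite [R1T x y]mxE linearZ.
rewrite rep_infinitesimal linear_sum.
transitivity (\sum_k ((i == k)%:R + 'X_(mxvec_index i k)) * (R1T x z)^`M(mxvec_index j k)).
  apply: eq_bigr => k _; rewrite [R1T x z]mxE mderiv_psub_oneDT.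
  by rewrite /= psubXM oneDE mul1r 2!mxE eq_sym.
under eq_bigr do rewrite mulrDl; rewrite big_split /=; congr (_ + _).
rewrite (bigD1 i) //= eqxx mul1r big1 ?addr0 // => k.
by rewrite eq_sym => /negPf->; rewrite mul0r.
Qed.

End Infinitesimal.

(** * Stability under the Kirillov-Wei operator *)

Section CharacteristicPolynomial.
Variables (K : numFieldType) (n : nat).
Local Notation H := (genericmx K n).
Local Notation S := {mpoly K[n * n]}.

Definition chip : {poly S} := char_poly H.
Let M : 'M[{poly S}]_n := char_poly_mx H.
Let dd (i j : 'I_n) : {poly S} -> {poly S} := map_poly (mderiv (mxvec_index i j)).

Let der_dd i j : derivation (dd i j).
Proof. exact/derivation_map_poly/derivation_mderiv. Qed.

Let ddM a b p q : dd a b (M p q) = - ((p == a) && (q == b))%:R.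
Proof.
have ddX : dd a b 'X = 0.
  rewrite -['X]mulr1 -polyC1 /dd map_poly_derivXC; last exact: derivation_mderiv.
  by rewrite -mpolyC1 mderivC mulr0.
rewrite !mxE (derivationD (der_dd _ _)) (derivationN (der_dd _ _)).
rewrite {2}/dd map_poly_derivC; last exact: derivation_mderiv.
rewrite mderivXU mxvec_index_eq polyC_natr.
by case: (p == q); rewrite ?mulr1n ?ddX ?mulr0n ?(derivation0 (der_dd _ _)) add0r.
Qed.

Let dd_chip a b : dd a b chip = - cofactor M a b.
Proof.
rewrite /chip /char_poly -/M (derivation_det (der_dd _ _)) (bigD1 a) //=.
rewrite [X in _ + X]big1 ?addr0 => [|p /negPf pa]; last first.
  by rewrite det_rowrep big1 // => q _; rewrite ddM pa oppr0 mul0r.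
rewrite det_rowrep (bigD1 b) //= big1 ?addr0 => [|q /negPf qb].
  by rewrite ddM !eqxx mulN1r.
by rewrite ddM qb andbF oppr0 mul0r.
Qed.

Let dd_cofactor a b i j : a != i ->
  dd a b (cofactor M i j) = - \det (rowrep a (ebase _ b) (rowrep i (ebase _ j) M)).
Proof.
move=> ai; rewrite (derivation_cofactor (der_dd _ _)) (bigD1 a) //=.
rewrite [X in _ + X]big1 ?addr0 => [|p /andP[_ /negPf pa]]; last first.
  by rewrite det_rowrep big1 // => q _; rewrite ddM pa oppr0 mul0r.
rewrite !det_rowrep -sumrN; apply: eq_bigr => q _; rewrite -mulNr; congr (_ * _).
by rewrite ddM eqxx.
Qed.

Let dd_cofactor_self a b j : dd a b (cofactor M a j) = 0.
Proof.
rewrite (derivation_cofactor (der_dd _ _)) big1 // => p /negPf pa.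
by rewrite det_rowrep big1 // => q _; rewrite ddM pa oppr0 mul0r.
Qed.

Let chip_antisym i j k : dd i k (dd j i chip) = - dd i i (dd j k chip).
Proof.
rewrite !dd_chip !(derivationN (der_dd _ _)) opprK.
have [->|ij] := eqVneq i j; first by rewrite !dd_cofactor_self oppr0.
by rewrite !dd_cofactor // opprK det_rowrep_swap.
Qed.

Let deriv_chip : chip^`() = - \sum_i dd i i chip.
Proof.
have der : derivation (fun p : {poly S} => p^`()).
  by split=> p q; [exact: derivD | exact: derivM].
rewrite /chip /char_poly -/M (derivation_det der) -sumrN; apply: eq_bigr => i _.
rewrite -/M -/(char_poly H) -/chip dd_chip opprK -det_rowrep_ebase.
congr (\det _); apply: eq_rowrep => j.
by rewrite !mxE derivB derivC subr0 derivMn derivX eq_sym.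
Qed.

Lemma chip_contract j k :
  \sum_i dd i k (dd j i chip) = dd j k chip^`().
Proof.
rewrite deriv_chip (derivationN (der_dd _ _)) (derivation_sum (der_dd _ _)) -sumrN.
apply: eq_bigr => i _; rewrite chip_antisym; congr (- _).
by apply/polyP => q; rewrite !coef_map_id0 ?linear0 //= mderiv_comm.
Qed.

Definition chi_comb (lam : nat -> K) : S := \sum_(q < n.+1) lam q *: chip`_q.

Lemma chi_comb_contract lam j k :
  \sum_i (chi_comb lam)^`M(mxvec_index j i)^`M(mxvec_index i k) =
  (chi_comb (fun q => q%:R * lam q.-1))^`M(mxvec_index j k).
Proof.
have coefE q : \sum_i chip`_q^`M(mxvec_index j i)^`M(mxvec_index i k) =
    (chip`_q.+1 *+ q.+1)^`M(mxvec_index j k).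
  have /(congr1 (fun p : {poly S} => p`_q)) := chip_contract j k.
  rewrite coef_sum coef_map_id0 ?linear0 // coef_deriv => <-.
  by apply: eq_bigr => i _; rewrite !coef_map_id0 ?linear0.
transitivity (\sum_(q < n.+1) (q.+1%:R * lam q) *: chip`_q.+1^`M(mxvec_index j k)).
  have dsum c (F : 'I_n.+1 -> S) : (\sum_q F q)^`M(c) = \sum_q (F q)^`M(c).
    by rewrite linear_sum.
  rewrite /chi_comb; under eq_bigr do rewrite 2!dsum.
  rewrite exchange_big; apply: eq_bigr => q _ /=.
  under eq_bigr do rewrite 2!mderivZ.
  by rewrite -scaler_sumr coefE mderivMn -scaler_nat scalerA mulrC.
rewrite [RHS]linear_sum big_ord_recr big_ord_recl /= mul0r scale0r linear0 add0r.
rewrite [X in _ + X](_ : _ = 0) ?addr0; last first.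
  by rewrite nth_default ?linear0 ?scaler0 // /chip size_char_poly.
by apply: eq_bigr => q _; rewrite linearZ.
Qed.

Lemma chi_comb_exp z : chi_comb (fun q => z ^+ q) = chi n z.
Proof.
transitivity (chip.[z%:MP]).
  rewrite (@horner_coef_wide _ n.+1) ?size_char_poly //.
  apply: eq_bigr => q _; rewrite -mul_mpolyC mulrC; congr (_ * _).
  exact: (rmorphXn (@mpolyC _ K)).
rewrite /chip /char_poly /chi -[LHS]/(horner_eval _ _) -det_map_mx; congr (\det _).
apply/matrixP => i j.
by rewrite !mxE rmorphB rmorphMn /= /horner_eval hornerX hornerC.
Qed.

End CharacteristicPolynomial.

Lemma sum_mxvec_index (V : nmodType) m n (F : 'I_(m * n) -> V) :
  \sum_k F k = \sum_i \sum_j F (mxvec_index i j).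
Proof.
rewrite (reindex (uncurry (@mxvec_index m n))) /=; last exact: curry_mxvec_bij.
by rewrite pair_bigA; apply: eq_bigr => -[].
Qed.

Section WeightedGenerators.
Variables (K : numFieldType) (n m : nat) (rho : polyRep K n m).
Local Notation R := (rep_coef rho).
Local Notation H := (genericmx K n).
Local Notation R1T := (map_mx (psub (oneD 1 H^T)) R).
Local Notation ix := mxvec_index.

Definition wgen (phi lam : nat -> K) : 'M[{mpoly K[n * n]}]_m :=
  map_mx (fun f => diffop (wdeg phi f) (chi_comb n lam)) R1T.

Lemma wgenE phi lam x y :
  wgen phi lam x y = diffop (wdeg phi (R1T x y)) (chi_comb n lam).
Proof. by rewrite mxE. Qed.

Lemma wgen_exp s z : wgen (fun q => s ^+ q) (fun q => z ^+ q) = normal_gen rho s z.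
Proof.
apply/matrixP => x y; rewrite wgenE [RHS]mxE chi_comb_exp; congr (diffop _ _).
rewrite [R1T x y]mxE wdeg_exp msubst_psub; congr (psub _ _); apply/matrixP => i j.
rewrite [LHS]mxE (oneDE 1) (oneDE s) mul1r [H^T i j]mxE [H j i]mxE.
by rewrite msubstD msubstX (rmorph_nat (msubst _)).
Qed.

Lemma kirillov_wei_wgen phi lam :
  kirillov_wei rho (wgen phi lam) =
  wgen (fun q => q%:R * phi q.-1) lam +
  wgen (fun q => q%:R * phi q) (fun q => q%:R * lam q.-1).
Proof.
apply/matrixP => x z; rewrite [RHS]mxE !wgenE summxE.
under eq_bigr do rewrite summxE.
pose f := R1T x z; pose P := chi_comb n lam.
rewrite -/f -/P.
transitivity (\sum_i \sum_j (diffop ('X_(ix j i) * (wdeg (fun q => phi q.-1) f)^`M(ix j i)) P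
   + \sum_k diffop (wdeg phi f)^`M(ix j k) P^`M(ix j i)^`M(ix i k))).
  apply: eq_bigr => i _; apply: eq_bigr => j _; rewrite lie_rep_delta mxE.
  transitivity (diffop (wdeg phi (\sum_y lie_unit rho i j y z *: R1T x y)) P^`M(ix j i)).
    rewrite (linear_sum (wdeg phi)) diffop_suml; apply: eq_bigr => y _.
    rewrite [dermx _ _ _ _ _]mxE wgenE mderiv_diffop [constmx _ _ _ _]mxE mulrC mul_mpolyC.
    by rewrite linearZ diffopZl.
  rewrite rep_infinitesimal_shifted -/f linearD diffopDl /=; congr (_ + _).
    by rewrite -mderiv_wdeg mulrC diffopM diffopX.
  rewrite (linear_sum (wdeg phi)) diffop_suml; apply: eq_bigr => k _ /=.
  by rewrite wdeg_mulX_deriv mulrC diffopM diffopX.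
rewrite (eq_bigr _ (fun i _ => big_split _ _ _ _ _)) big_split /=; congr (_ + _).
  rewrite exchange_big -euler_wdeg sum_mxvec_index diffop_suml; apply: eq_bigr => j _ /=.
  by rewrite diffop_suml.
rewrite exchange_big -euler_wdeg sum_mxvec_index diffop_suml; apply: eq_bigr => j _ /=.
rewrite exchange_big diffop_suml; apply: eq_bigr => k _ /=.
rewrite mulrC diffopM diffopX -chi_comb_contract.
by rewrite (linear_sum (diffop _)).
Qed.

(* [wgen] is linear in its first argument, so sums give all linear combinations. *)
Definition wgen_span (F : 'M[{mpoly K[n * n]}]_m) : Prop :=
  exists s : seq ((nat -> K) * (nat -> K)), F = \sum_(x <- s) wgen x.1 x.2.

Lemma kirillov_weiD F G :
  kirillov_wei rho (F + G) = kirillov_wei rho F + kirillov_wei rho G.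
Proof.
rewrite /kirillov_wei -big_split; apply: eq_bigr => i _ /=.
rewrite -big_split; apply: eq_bigr => j _ /=; rewrite -mulmxDl; congr (_ *m _).
by apply/matrixP => a b; rewrite !mxE mderivD.
Qed.

Lemma wgen_span_wei F : wgen_span F -> wgen_span (kirillov_wei rho F).
Proof.
case=> s ->; elim: s => [|x s [s' IH]].
  exists [::]; rewrite !big_nil; apply: (addrI (kirillov_wei rho 0)).
  by rewrite -kirillov_weiD !addr0.
exists ((fun q => q%:R * x.1 q.-1, x.2) ::
        (fun q => q%:R * x.1 q, fun q => q%:R * x.2 q.-1) :: s').
by rewrite !big_cons kirillov_weiD kirillov_wei_wgen IH addrA.
Qed.

Lemma wgen_span_invc k : wgen_span (Defs.invc K n k)%:M.
Proof.
exists [:: (fun q => (q == 0%N)%:R, fun q => (-1) ^+ (n - k) * (-1) ^+ n *+ (q == (n - k)%N))].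
rewrite big_seq1 /=; apply/matrixP => x y; rewrite wgenE wdeg_delta0 diffopC.
have -> : (R1T x y)@_0 = (x == y)%:R.
  have /matrixP/(_ x y) := rep_one rho; rewrite mcoeff0_meval 3!mxE meval_psub => <-.
  apply: meval_eq => l; case/mxvec_indexP: l => i j; rewrite !mxvecE mxE oneDE.
  rewrite mevalD mevalM !mxE mevalXU mulr0 addr0 (rmorph_nat (meval _)) //.
rewrite mxE; case: (x == y); rewrite ?scale0r // scale1r /=.
have lt_nk : (n - k < n.+1)%N by rewrite ltnS leq_subr.
rewrite /chi_comb (bigD1 (Ordinal lt_nk)) //= eqxx mulr1n big1 ?addr0; last first.
  by move=> q /negPf; rewrite -val_eqE /= => ->; rewrite mulr0n scale0r.
rewrite /Defs.invc.
have -> : map_mx polyC H - 'X%:M = - char_poly_mx H by rewrite opprB.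
rewrite -(scaleN1r (char_poly_mx H)) detZ -/(char_poly H) -/(chip K n).
have -> : (-1) ^+ n = ((-1) ^+ n)%:P :> {poly {mpoly K[n * n]}}.
  by rewrite rmorphXn rmorphN1.
rewrite coefCM -[RHS]mul_mpolyC mulrA; congr (_ * _).
by rewrite rmorphM !rmorphXn !rmorphN1.
Qed.

Lemma wgen_span_bigM p q : wgen_span (bigM rho p q).
Proof.
rewrite /bigM; elim: q (p + q)%N => [|q IH] k; first exact: wgen_span_invc.
by rewrite iterS; apply/wgen_span_wei/IH.
Qed.


End WeightedGenerators.

(** * Interpolation *)

Lemma power_interpolation (K : fieldType) d (x : 'I_d -> K) (phi : nat -> K) :
  injective x ->
  exists c : 'I_d -> K, forall q, (q < d)%N -> phi q = \sum_i c i * x i ^+ q.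
Proof.
move=> inj_x; pose V : 'M[K]_d := Vandermonde d (\row_i x i).
have Vu : V \in unitmx.
  rewrite unitmxE unitfE det_Vandermonde; apply/prodf_neq0 => i _.
  apply/prodf_neq0 => j ij; rewrite !mxE subr_eq0 (inj_eq inj_x).
  by apply: contraTneq ij => ->; rewrite ltnn.
pose c := invmx V *m \col_q phi q; exists (fun i => c i 0) => q lt_qd.
have /matrixP/(_ (Ordinal lt_qd) 0) : V *m c = \col_q phi q by rewrite mulKVmx.
rewrite !mxE => <-; apply: eq_bigr => i _.
by rewrite [V _ _]mxE mxE mulrC.
Qed.

Lemma comm_mx_scale (R : comPzRingType) m a b (F G : 'M[R]_m) :
  F *m G = G *m F -> (a *: F) *m (b *: G) = (b *: G) *m (a *: F).
Proof. by move=> FG; rewrite -!scalemxAl -!scalemxAr FG !scalerA mulrC. Qed.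

Section Commutation.
Variables (K : numFieldType) (n m : nat) (rho : polyRep K n m).
Local Notation R1T := (map_mx (psub (oneD 1 (genericmx K n)^T)) (rep_coef rho)).

Let deg_bound := \max_(x < m) \max_(y < m) msize (R1T x y).

Let msize_bound x y : (msize (R1T x y) <= deg_bound)%N.
Proof.
apply: (@leq_trans (\max_(y < m) msize (R1T x y))).
  exact: (@leq_bigmax _ (fun y => msize (R1T x y)) y).
exact: (@leq_bigmax _ (fun x => \max_(y < m) msize (R1T x y)) x).
Qed.

Lemma wgen_interpolation phi lam (x : 'I_deg_bound -> K) : injective x ->
  exists c : 'I_deg_bound -> 'I_n.+1 -> K, wgen rho phi lam =
    \sum_i \sum_j (c i j)%:MP *: normal_gen rho (x i) j%:R.
Proof.
move=> inj_x; have [a aE] := power_interpolation phi inj_x.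
have [|b bE] := @power_interpolation K n.+1 (fun j => j%:R) lam.
  by move=> i j /eqP; rewrite eqr_nat => /eqP/val_inj.
exists (fun i j => a i * b j); apply/matrixP => k l; rewrite wgenE summxE.
have -> : chi_comb n lam = \sum_j b j *: chi_comb n (fun q => j%:R ^+ q).
  rewrite /chi_comb; under [RHS]eq_bigr do rewrite scaler_sumr.
  rewrite exchange_big; apply: eq_bigr => q _ /=; rewrite bE // scaler_suml.
  by apply: eq_bigr => j _; rewrite scalerA.
have -> : wdeg phi (R1T k l) = \sum_i a i *: wdeg (fun q => x i ^+ q) (R1T k l).
  apply/mpolyP => w; rewrite mcoeff_wdeg linear_sum /=.
  under eq_bigr do rewrite mcoeffZ mcoeff_wdeg mulrA.
  rewrite -mulr_suml; have [wf|/memN_msupp_eq0->] := boolP (w \in msupp (R1T k l)).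
    by rewrite -aE // (leq_trans (msize_mdeg_lt wf) (msize_bound k l)).
  by rewrite !mulr0.
rewrite diffop_suml; apply: eq_bigr => i _; rewrite summxE (linear_sum (diffop _)).
apply: eq_bigr => j _ /=; rewrite diffopZl linearZ /= scalerA.
by rewrite [RHS]mxE -wgen_exp wgenE mul_mpolyC.
Qed.

Lemma wgen_comm phi lam psi mu :
  wgen rho phi lam *m wgen rho psi mu = wgen rho psi mu *m wgen rho phi lam.
Proof.
have [|c ->] := @wgen_interpolation phi lam (fun i => i%:R).
  by move=> i j /eqP; rewrite eqr_nat => /eqP/val_inj.
have [|e ->] := @wgen_interpolation psi mu (fun i => (deg_bound + i)%:R).
  by move=> i j /eqP; rewrite eqr_nat eqn_add2l => /eqP/val_inj.
apply: comm_mx_sum => k _; apply: comm_mx_sum => l _; symmetry.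
apply: comm_mx_sum => i _; apply: comm_mx_sum => j _.
apply/comm_mx_scale/normal_gen_comm; rewrite eqr_nat eq_sym.
by rewrite neq_ltn (leq_trans (ltn_ord i)) ?leq_addr.
Qed.

Lemma wgen_span_comm F G : wgen_span rho F -> wgen_span rho G -> F *m G = G *m F.
Proof.
move=> [s ->] [r ->]; apply: comm_mx_sum => x _; symmetry.
by apply: comm_mx_sum => y _; apply: wgen_comm.
Qed.

End Commutation.

(** * Equivariance *)

Lemma dual_bases_sum (K : fieldType) n m (u v : 'I_n -> 'I_n -> K)
    (E L : 'I_n -> 'M[K]_m) :
  (forall a d, \sum_j u a j * v j d = (a == d)%:R) ->
  \sum_j (\sum_a u a j *: E a) *m (\sum_d v j d *: L d) = \sum_a E a *m L a.
Proof.
move=> uv; transitivity (\sum_a \sum_d (\sum_j u a j * v j d) *: (E a *m L d)).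
  under eq_bigr do rewrite mulmx_suml.
  rewrite exchange_big; apply: eq_bigr => a _ /=.
  under eq_bigr do rewrite mulmx_sumr.
  rewrite exchange_big; apply: eq_bigr => d _ /=.
  by rewrite scaler_suml; apply: eq_bigr => j _; rewrite -scalemxAl -scalemxAr scalerA.
apply: eq_bigr => a _; rewrite (bigD1 a) //= uv eqxx scale1r big1 ?addr0 // => d.
by rewrite uv eq_sym => /negPf->; rewrite scale0r.
Qed.

Section KirillovAlgebra.
Variables (K : numFieldType) (n m : nat) (rho : polyRep K n m).
Local Notation R := (rep_coef rho).
Local Notation H := (genericmx K n).
Local Notation ix := mxvec_index.
Implicit Types (F G : 'M[{mpoly K[n * n]}]_m) (g Y : 'M[K]_n).

Lemma rep_inv g : g \in unitmx ->
  rep rho g \in unitmx /\ invmx (rep rho g) = rep rho (invmx g).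
Proof.
move=> ug; have gg : rep rho g *m rep rho (invmx g) = 1%:M.
  by rewrite /rep -rep_mul ?unitmx_inv // mulmxV // rep_one.
have [ur _] := mulmx1_unit gg; split=> //.
by rewrite -[RHS](mulKmx ur) gg mulmx1.
Qed.

Definition conjmx g : 'M[{mpoly K[n * n]}]_n :=
  map_mx (@mpolyC _ K) g *m H *m map_mx (@mpolyC _ K) (invmx g).

Lemma evalmx_conj F g Y :
  evalmx (map_mx (psub (conjmx g)) F) Y = evalmx F (g *m Y *m invmx g).
Proof.
have constK (B : 'M[K]_n) w : map_mx (meval w) (map_mx (@mpolyC (n * n) K) B) = B.
  by apply/matrixP => i j; rewrite !mxE mevalC.
apply/matrixP => x y; rewrite !mxE meval_psub !map_mxM !constK.
apply: meval_eq => k; congr (mxvec (_ *m _ *m _) _ _).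
apply/matrixP => i j; rewrite [LHS]mxE [H i j]mxE.
exact: etrans (mevalXU _ _) (mxvecE _ _ _).
Qed.

Lemma eq_evalmx F G : (forall Y, evalmx F Y = evalmx G Y) -> F = G.
Proof.
move=> FG; apply/matrixP => x y; apply: eq_meval => v.
have /matrixP/(_ x y) := FG (vec_mx (\row_k v k)); rewrite !mxE.
have vE : (fun k => mxvec (vec_mx (\row_k v k)) 0 k) =1 v.
  by move=> k; rewrite vec_mxK mxE.
by rewrite !(meval_eq _ vE).
Qed.

Lemma mderiv_conjmx g i j a b :
  (conjmx g a b)^`M(ix j i) = (g a j * invmx g i b)%:MP.
Proof.
have -> : conjmx g a b = \sum_c \sum_d (g a d * invmx g c b) *: 'X_(ix d c).
  rewrite mxE; apply: eq_bigr => c _; rewrite mxE mulr_suml; apply: eq_bigr => d _.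
  by rewrite !mxE -mul_mpolyC mpolyCM mulrAC.
rewrite linear_sum (bigD1 i) //= linear_sum (bigD1 j) //= mderivZ mderivXU eqxx.
rewrite [X in _ + X + _]big1 ?[X in _ + X]big1 ?addr0 => [|c /negPf ci|d /negPf dj].
- by rewrite -mul_mpolyC mulr1.
- by rewrite linear_sum big1 // => d _ /=; rewrite mderivZ mderivXU mxvec_index_eq ci andbF scaler0.
by rewrite mderivZ mderivXU mxvec_index_eq dj scaler0.
Qed.

Lemma evalmxM F G Y : evalmx (F *m G) Y = evalmx F Y *m evalmx G Y.
Proof. exact: map_mxM. Qed.
Lemma evalmxD F G Y : evalmx (F + G) Y = evalmx F Y + evalmx G Y.
Proof. exact: map_mxD. Qed.
Lemma evalmx_const (B : 'M[K]_m) Y : evalmx (constmx n B) Y = B.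
Proof. by apply/matrixP => i j; rewrite !mxE mevalC. Qed.

Lemma kirillov_deriv F g Y i j : kirillov_algebra rho F -> g \in unitmx ->
  \sum_a \sum_b (g a j * invmx g i b) *: evalmx (dermx a b F) (g *m Y *m invmx g) =
  rep rho g *m evalmx (dermx j i F) Y *m invmx (rep rho g).
Proof.
move=> kF ug.
have EF : map_mx (psub (conjmx g)) F =
    constmx n (rep rho g) *m F *m constmx n (invmx (rep rho g)).
  by apply: eq_evalmx => Z; rewrite evalmx_conj kF // !evalmxM !evalmx_const.
have dM (A B : 'M[K]_m) : dermx j i (constmx n A *m F *m constmx n B) =
    constmx n A *m dermx j i F *m constmx n B.
  have entry G x y : (constmx n A *m G *m constmx n B) x y =
      \sum_c \sum_d (A x d * B c y)%:MP * G d c.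
    rewrite mxE; apply: eq_bigr => c _; rewrite [constmx _ _ _ _]mxE mxE mulr_suml.
    by apply: eq_bigr => d _; rewrite [constmx _ _ _ _]mxE mpolyCM mulrAC.
  apply/matrixP => x y; rewrite entry mxE entry linear_sum; apply: eq_bigr => c _ /=.
  by rewrite linear_sum; apply: eq_bigr => d _; rewrite /= mderiv_mulC [dermx _ _ _ _ _]mxE.
have := congr1 (fun F => evalmx (dermx j i F) Y) EF.
rewrite dM 2!evalmxM !evalmx_const => <-.
apply/matrixP => x y; rewrite summxE 3!mxE mderiv_psub raddf_sum.
apply: eq_bigr => a _; rewrite summxE /= raddf_sum; apply: eq_bigr => b _ /=.
rewrite mderiv_conjmx mevalM mevalC [RHS]mulrC [LHS]mxE; congr (_ * _).
have /matrixP/(_ x y) := evalmx_conj (dermx a b F) g Y.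
by rewrite [LHS]mxE [map_mx _ _ x y]mxE [dermx a b F x y]mxE => ->.
Qed.

Lemma kirillov_rep_coef : kirillov_algebra rho R.
Proof.
move=> g Y ug; have [ur rV] := rep_inv ug; rewrite rV -evalmx_conj.
have det_const (B : 'M[K]_n) : B \in unitmx -> \det (map_mx (@mpolyC (n * n) K) B) != 0.
  move=> uB; apply/eqP => /(congr1 (meval (fun=> 0))) /eqP; rewrite meval0 -det_map_mx.
  have -> : map_mx (meval (fun=> 0)) (map_mx (@mpolyC (n * n) K) B) = B.
    by apply/matrixP => i j; rewrite !mxE mevalC.
  by apply/negP; rewrite -unitfE -unitmxE.
have det_H : \det H != 0.
  apply/eqP => /(congr1 (meval (fun k => mxvec 1%:M 0 k))) /eqP; rewrite meval0 -det_map_mx.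
  have -> : map_mx (meval (fun k => mxvec 1%:M 0 k)) H = 1%:M :> 'M[K]_n.
    by apply/matrixP => i j; rewrite [LHS]mxE [H i j]mxE mevalXU mxvecE.
  by rewrite det1 oner_eq0.
have psubC (B : 'M[K]_n) : map_mx (psub (map_mx (@mpolyC (n * n) K) B)) R = constmx n (rep rho B).
  by apply/matrixP => i j; rewrite !mxE psub_const.
have psubH : map_mx (psub H) R = R by apply/matrixP => i j; rewrite mxE psub_generic.
have det_gH : \det (map_mx (@mpolyC (n * n) K) g *m H) != 0.
  by rewrite det_mulmx mulf_neq0 ?det_const.
rewrite /conjmx -psub_rep_mul ?det_const ?unitmx_inv // -psub_rep_mul ?det_const //.
by rewrite !psubC psubH !evalmxM !evalmx_const.
Qed.

Lemma evalmx_kirillov_wei F Y : evalmx (kirillov_wei rho F) Y =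
  \sum_i \sum_j evalmx (dermx j i F) Y *m lie_unit rho i j.
Proof.
rewrite /kirillov_wei /evalmx raddf_sum; apply: eq_bigr => i _ /=.
rewrite raddf_sum; apply: eq_bigr => j _ /=.
by rewrite -/(evalmx _ Y) evalmxM evalmx_const lie_rep_delta.
Qed.

Lemma kirillov_wei_closed F : kirillov_algebra rho F ->
  kirillov_algebra rho (kirillov_wei rho F).
Proof.
move=> kF g Y ug; have [ur rV] := rep_inv ug.
pose Z := g *m Y *m invmx g; pose E a b := evalmx (dermx a b F) Z.
rewrite !evalmx_kirillov_wei mulmx_sumr mulmx_suml.
have lieE i j : \sum_c \sum_d (g c i * invmx g j d) *: lie_unit rho c d =
    rep rho g *m lie_unit rho i j *m invmx (rep rho g).
  by have := kirillov_deriv 1%:M j i kirillov_rep_coef ug; rewrite mulmx1 mulmxV.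
transitivity (\sum_i \sum_j (\sum_a \sum_b (g a j * invmx g i b) *: E a b) *m
    (\sum_c \sum_d (g c i * invmx g j d) *: lie_unit rho c d)); last first.
  apply: eq_bigr => i _; rewrite mulmx_sumr mulmx_suml; apply: eq_bigr => j _.
  rewrite lieE kirillov_deriv // !mulmxA; congr (_ *m _ *m _).
  by rewrite -!mulmxA mulVmx ?mulmx1.
have gV a d : \sum_j g a j * invmx g j d = (a == d)%:R.
  by have /matrixP/(_ a d) := mulmxV ug; rewrite !mxE.
symmetry; transitivity (\sum_i \sum_a (\sum_b invmx g i b *: E a b) *m
    (\sum_c g c i *: lie_unit rho c a)).
  apply: eq_bigr => i _; rewrite -[RHS](dual_bases_sum _ _ gV); apply: eq_bigr => j _.
  congr (_ *m _).
    apply: eq_bigr => a _; rewrite scaler_sumr; apply: eq_bigr => b _.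
    by rewrite scalerA.
  rewrite [LHS]exchange_big; apply: eq_bigr => d _; rewrite scaler_sumr.
  by apply: eq_bigr => c _; rewrite scalerA mulrC.
rewrite exchange_big [RHS]exchange_big; apply: eq_bigr => a _ /=.
rewrite (@dual_bases_sum _ _ _ (fun b i => invmx g i b) (fun i c => g c i)) // => b c.
by under eq_bigr do rewrite mulrC; rewrite gV eq_sym.
Qed.

Lemma kirillov_scalar (c : {mpoly K[n * n]}) :
  (forall g Y, g \in unitmx ->
     c.@[fun k => mxvec (g *m Y *m invmx g) 0 k] = c.@[fun k => mxvec Y 0 k]) ->
  kirillov_algebra rho c%:M.
Proof.
move=> cinv g Y ug; have [ur _] := rep_inv ug.
have evalS Z : evalmx c%:M Z = (c.@[fun k => mxvec Z 0 k])%:M.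
  by apply/matrixP => i j; rewrite !mxE raddfMn.
by rewrite !evalS cinv // mul_mx_scalar -scalemxAl mulmxV // scalemx1.
Qed.

Lemma char_poly_conj (g Y : 'M[K]_n) : g \in unitmx ->
  char_poly (g *m Y *m invmx g) = char_poly Y.
Proof. by move=> ug; rewrite char_poly_mulmxC mulmxA mulVmx // mul1mx. Qed.

Lemma kirillov_invc k : kirillov_algebra rho (Defs.invc K n k)%:M.
Proof.
apply: kirillov_scalar => g Y ug.
have invcE Z : (Defs.invc K n k).@[fun l => mxvec Z 0 l] =
    (-1) ^+ (n - k) * ((-1) ^+ n * (char_poly Z)`_(n - k)).
  pose ev := meval (fun l => mxvec Z 0 l) : {rmorphism {mpoly K[n * n]} -> K}.
  rewrite /Defs.invc -/(ev _) rmorphM rmorphXn rmorphN1; congr (_ * _).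
  rewrite -coef_map -det_map_mx.
  have -> : map_mx (map_poly ev) (map_mx polyC H - 'X%:M) = - char_poly_mx Z.
    apply/matrixP => i j; rewrite !mxE rmorphB rmorphMn /= map_polyX map_polyC opprB.
    congr (_%:P - _); exact: etrans (mevalXU _ _) (mxvecE _ _ _).
  rewrite -(scaleN1r (char_poly_mx Z)) detZ -/(char_poly Z).
  have -> : (-1) ^+ n = ((-1) ^+ n)%:P :> {poly K} by rewrite rmorphXn rmorphN1.
  by rewrite coefCM.
by rewrite !invcE char_poly_conj.
Qed.

Lemma kirillov_bigM p q : kirillov_algebra rho (bigM rho p q).
Proof.
rewrite /bigM; elim: q (p + q)%N => [|q IH] k; first exact: kirillov_invc.
by rewrite iterS; apply/kirillov_wei_closed/IH.
Qed.

Lemma commutant_subalg (S : 'M[{mpoly K[n * n]}]_m -> Prop) :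
  is_subalg (fun F => kirillov_algebra rho F /\ forall G, S G -> F *m G = G *m F).
Proof.
split.
- split=> [|G _]; last by rewrite mul1mx mulmx1.
  apply: kirillov_scalar => g Y _; by rewrite !meval1.
- move=> F1 F2 [k1 c1] [k2 c2]; split=> [g Y ug|G SG].
    by rewrite !evalmxD k1 // k2 // mulmxDr mulmxDl.
  by rewrite mulmxDl mulmxDr c1 // c2.
- move=> a F [kF cF]; split=> [g Y ug|G SG].
    have evalZ Z : evalmx (a%:MP *: F) Z = a *: evalmx F Z.
      by apply/matrixP => i j; rewrite !mxE mevalM mevalC.
    by rewrite !evalZ kF // -scalemxAr -scalemxAl.
  by rewrite -scalemxAl -scalemxAr cF.
move=> F1 F2 [k1 c1] [k2 c2]; split=> [g Y ug|G SG].
  have [ur _] := rep_inv ug; rewrite !evalmxM k1 // k2 // !mulmxA.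
  by congr (_ *m _ *m _); rewrite -!mulmxA mulVmx ?mulmx1.
by symmetry; apply: comm_mxM; symmetry; [exact: c1 | exact: c2].
Qed.

Lemma big_algebra_comm F G : big_algebra rho F -> big_algebra rho G -> F *m G = G *m F.
Proof.
pose gens F := exists p q : nat, (p + q <= n)%N /\ F = bigM rho p q.
have gens_kir F0 : gens F0 -> kirillov_algebra rho F0.
  by case=> p [q [_ ->]]; apply: kirillov_bigM.
have gens_comm F0 G0 : gens F0 -> gens G0 -> F0 *m G0 = G0 *m F0.
  by case=> p [q [_ ->]] [p' [q' [_ ->]]]; apply: wgen_span_comm; apply: wgen_span_bigM.
have big_gens F0 : big_algebra rho F0 -> forall G0, gens G0 -> F0 *m G0 = G0 *m F0.
  move=> bF0; have [_ [] //|G0 gG0|//] := bF0 _ (commutant_subalg gens).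
  by split=> [|G1]; [exact: gens_kir | exact: gens_comm].
move=> bF bG; have [_ [] //|G0 gG0|_ ->//] := bG _ (commutant_subalg (eq^~ F)).
by split=> [|_ ->]; [exact: gens_kir | rewrite (big_gens F)].
Qed.

End KirillovAlgebra.

Theorem theorem1p1 (R : realType) (n m : nat) (rho : polyRep R[i] n m)
    (n_gt0 : (0 < n)%N) (irr : irreducible_rep rho)
    (F G : 'M[{mpoly R[i][n * n]}]_m)
    (hF : big_algebra rho F) (hG : big_algebra rho G) :
  F *m G = G *m F.
Proof. exact: big_algebra_comm hF hG. Qed.
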